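(* Let $(M,g)$ be an oriented Riemannian manifold of dimension $n$ and $\Omega$ a smooth $2$-form on $M$. For all (constant) $x,y\in\mathbb R^n$, as $\mathfrak{so}(n)$-valued functions on $FM$, $$\mathbf R^\Omega(x,y)=\mathbf R(x,y)+B_xT_y-B_yT_x+\tfrac14\Big(\|\mathbf\Omega e_1\|^2x^\perp\wedge y^\perp+[\mathbf\Omega^2x]^\perp\wedge y+x\wedge[\mathbf\Omega^2y]^\perp-\mathbf\Omega x\wedge\mathbf\Omega y-2\langle\mathbf\Omega,x\wedge y\rangle\mathbf\Omega\Big).$$
   Context: $\Omega$ also denotes the skew endomorphism field with $\Omega(x,y)=g(\Omega x,y)$. For $x,y$ in a Euclidean space, $x\wedge y$ is the skew endomorphism $(x\wedge y)z=\langle x,z\rangle y-\langle y,z\rangle x$. $\mathfrak{so}(n)$ carries $\langle\xi,\eta\rangle=-\frac12\mathrm{Tr}(\xi\eta)$, with orthonormal basis $(\omega_\alpha)=(e_i\wedge e_j)_{i<j}$; thus $\langle\xi,x\wedge y\rangle=\langle\xi x,y\rangle$. For $x\in\mathbb R^n$, $x^\perp=[x]^\perp=x-\langle x,e_1\rangle e_1$. $FM$ is the bundle of oriented orthonormal frames, seen as isometries $w:\mathbb R^n\to T_pM$, with right action $R_aw=w\circ a$ of $\mathrm{SO}(n)$. $Y_\xi=\frac{d}{dt}|_{t=0}R_{\exp(t\xi)}$ for $\xi\in\mathfrak{so}(n)$; $B_x|_w$ is the Levi-Civita horizontal lift of $w(x)$ for $x\in\mathbb R^n$. For functions $\xi:FM\to\mathfrak{so}(n)$,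 $x:FM\to\mathbb R^n$ put $Y_\xi=\sum_\alpha\langle\xi,\omega_\alpha\rangle Y_{\omega_\alpha}$, $B_x=\sum_i\langle x,e_i\rangle B_{e_i}$. Vector fields act componentwise on vector-valued functions. $\mathbf\Omega_w=w^{-1}\Omega w$, and $\mathbf R(x,y)|_w=w^{-1}\mathcal R(w(x),w(y))w$ with $\mathcal R(X,Y)=[\nabla_X,\nabla_Y]-\nabla_{[X,Y]}$ the Riemann curvature. Put $\mathbf\Omega^0=\frac12(\mathbf\Omega-e_1\wedge\mathbf\Omega e_1)$, $\widetilde{\mathbf\Omega}=e_1\wedge\mathbf\Omega e_1+\mathbf\Omega^0$, $\mathbb X^\Omega=B_{e_1}+Y_{\widetilde{\mathbf\Omega}}$. Magnetic standard fields: $B^\Omega_{e_1}=\mathbb X^\Omega$, $B^\Omega_{e_j}=-[\mathbb X^\Omega,Y_{e_1\wedge e_j}]$ for $j\ge2$, $B^\Omega_x=\sum_i\langle x,e_i\rangle B^\Omega_{e_i}$. The contorsion $T_x:FM\to\mathfrak{so}(n)$ is defined by $B^\Omega_x=B_x-Y_{T_x}$. The torsion $\tau^\Omega(x,y):FM\to\mathbb R^n$ and the curvature $\mathbf R^\Omega(x,y):FM\to\mathfrak{so}(n)$ are defined by $-[B^\Omega_x,B^\Omega_y]=B^\Omega_{\tau^\Omega(x,y)}+Y_{\mathbf R^\Omega(x,y)}$ for constant $x,y\in\mathbb R^n$. $B_xT_y$ denotes the derivative of the function $T_y$ along $B_x$. *)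

(* Defs.v *)
From HB Require Import structures.
From mathcomp Require Import all_boot all_order all_algebra.
From mathcomp Require Import lra.
From mathcomp Require Import all_classical all_reals all_analysis.

Set Implicit Arguments.
Unset Strict Implicit.
Unset Printing Implicit Defensive.

Import Order.TTheory GRing.Theory Num.Theory.
Import numFieldNormedType.Exports.

Local Open Scope classical_set_scope.
Local Open Scope ring_scope.

(* Vectors of R^n are columns, endomorphisms of R^n are square matrices acting
   on the left. *)

Section LinearAlgebra.
Context {R : realType} {n : nat}.
Implicit Types (x y z : 'cV[R]_n) (A B : 'M[R]_n).

Definition basisv (i : 'I_n) : 'cV[R]_n := delta_mx i 0.

Definition dot x y : R := (x^T *m y) 0 0.

Definition bilin A x y : R := (x^T *m A *m y) 0 0.

Definition wedge x y : 'M[R]_n := y *m x^T - x *m y^T.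

Definition skew A : Prop := A^T = - A.

Definition so_dot A B : R := - (2^-1 * \tr (A *m B)).

Definition commutator A B : 'M[R]_n := A *m B - B *m A.

Lemma wedgeE x y z : wedge x y *m z = dot x z *: y - dot y z *: x.
Proof.
have aux (u v : 'cV[R]_n) : v *m u^T *m z = dot u z *: v.
  by rewrite -mulmxA [u^T *m z]mx11_scalar mul_mx_scalar.
by rewrite mulmxBl !aux.
Qed.

Lemma bilin_sym A x y : A^T = A -> bilin A x y = bilin A y x.
Proof.
move=> AE; rewrite /bilin.
have -> : x^T *m A *m y = (y^T *m A *m x)^T.
  by rewrite !trmx_mul trmxK AE mulmxA.
by rewrite mxE.
Qed.

End LinearAlgebra.

Section Smooth.
Context {R : realType} {V W : normedModType R}.

Fixpoint times_differentiable (k : nat) (U : set V) (f : V -> W) : Prop :=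
  if k is k'.+1 then
    (forall x, U x -> differentiable f x) /\
    (forall v, times_differentiable k' U (fun x => 'D_v f x))
  else True.

(* On an open set of a finite-dimensional space this is C^infinity: each
   iterated derivative is differentiable, hence continuous. *)
Definition smooth_on (U : set V) (f : V -> W) : Prop :=
  forall k, times_differentiable k U f.

End Smooth.

Section Manifold.
Context {R : realType}.

Record chart (M : topologicalType) (n : nat) := Chart {
  chart_dom : set M;
  chart_map :> M -> 'cV[R]_n;
  chart_inv : 'cV[R]_n -> M;
  chart_dom_open : open chart_dom;
  chart_img_open : open (chart_map @` chart_dom);
  chart_mapK : {in chart_dom, cancel chart_map chart_inv};
  chart_map_continuous : {in chart_dom, continuous chart_map};
  chart_inv_continuous : {in chart_map @` chart_dom, continuous chart_inv} }.

Definition chart_img M n (c : chart M n) : set 'cV[R]_n :=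
  c @` chart_dom c.

(* Jacobian matrix at p of the change of coordinates from c to c': it maps the
   components in c of a tangent vector at p to its components in c'. *)
Definition jac M n (c c' : chart M n) (p : M) : 'M[R]_n :=
  \matrix_(i, j) ('D_(basisv j) (c' \o chart_inv c) (c p)) i 0.

(* The orientation is given by the atlas: all changes of coordinates have
   positive Jacobian determinant.  Each point p comes with a preferred chart
   [chart_at p], in which T_pM is identified with R^n: throughout, a tangent
   vector at p is the column of its components in [chart_at p], and tensors at
   p are given by their matrices in the same basis. *)
Record oriented_manifold (M : topologicalType) (n : nat) := OrientedManifold {
  atlas : set (chart M n);
  chart_at : M -> chart M n;
  manifold_hausdorff : hausdorff_space M;
  manifold_second_countable : @second_countable M;
  chart_at_atlas : forall p, atlas (chart_at p);
  chart_at_dom : forall p, chart_dom (chart_at p) p;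
  atlas_smooth : forall c c', atlas c -> atlas c' ->
    smooth_on (c @` (chart_dom c `&` chart_dom c')) (c' \o chart_inv c);
  atlas_oriented : forall c c', atlas c -> atlas c' ->
    forall p, chart_dom c p -> chart_dom c' p -> 0 < \det (jac c c' p) }.

(* Matrix, in the coordinates of c, of a field S of bilinear forms on the
   tangent spaces, as a function on the image of c. *)
Definition form_in_chart M n (X : oriented_manifold M n) (S : M -> 'M[R]_n)
    (c : chart M n) (x : 'cV[R]_n) : 'M[R]_n :=
  let p := chart_inv c x in
  let J := jac c (chart_at X p) p in
  J^T *m S p *m J.

Record riemannian_metric M n (X : oriented_manifold M n) := RiemannianMetric {
  metric_mx :> M -> 'M[R]_n;
  metric_sym : forall p, (metric_mx p)^T = metric_mx p;
  metric_pos : forall p v, v != 0 -> 0 < bilin (metric_mx p) v v;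
  metric_smooth : forall c, atlas X c ->
    smooth_on (chart_img c) (form_in_chart X metric_mx c) }.

Record two_form M n (X : oriented_manifold M n) := TwoForm {
  form_mx :> M -> 'M[R]_n;
  form_skew : forall p, skew (form_mx p);
  form_smooth : forall c, atlas X c ->
    smooth_on (chart_img c) (form_in_chart X form_mx c) }.

Section Riemannian.
Context {M : topologicalType} {n : nat} {X : oriented_manifold M n}.
Variable g : riemannian_metric X.

(* The endomorphism of T_pM with Omega(u, v) = g(Omega u, v). *)
Definition form_endo (Om : two_form X) (p : M) : 'M[R]_n :=
  invmx (g p) *m (Om p)^T.

(* Gamma(u, v) at x in the chart c, from Koszul's formula for coordinate
   fields; that this is the Levi-Civita connection is checked below. *)
Definition christoffel (c : chart M n) (x u v : 'cV[R]_n) : 'cV[R]_n :=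
  let G := form_in_chart X g c in
  invmx (G x) *m \col_l (2^-1 *
    (bilin ('D_u G x) v (basisv l) + bilin ('D_v G x) u (basisv l)
     - bilin ('D_(basisv l) G x) u v)).

(* nabla_U V, for vector fields given by their components in the chart c. *)
Definition covariant (c : chart M n) (U V : 'cV[R]_n -> 'cV[R]_n)
    (x : 'cV[R]_n) : 'cV[R]_n :=
  'D_(U x) V x + christoffel c x (U x) (V x).

Definition field_bracket (U V : 'cV[R]_n -> 'cV[R]_n) (x : 'cV[R]_n) :
  'cV[R]_n := 'D_(U x) V x - 'D_(V x) U x.

(* R(U, V) Z = [nabla_U, nabla_V] Z - nabla_[U, V] Z *)
Definition curvature_field (c : chart M n) (U V Z : 'cV[R]_n -> 'cV[R]_n)
    (x : 'cV[R]_n) : 'cV[R]_n :=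
  covariant c U (covariant c V Z) x - covariant c V (covariant c U Z) x
  - covariant c (field_bracket U V) Z x.

(* The curvature tensor at p: tangent vectors at p are extended to fields with
   constant components in [chart_at p]. *)
Definition curvature (p : M) (u v z : 'cV[R]_n) : 'cV[R]_n :=
  curvature_field (chart_at X p) (cst u) (cst v) (cst z) (chart_at X p p).

Lemma metric_unit p : g p \in unitmx.
Proof.
rewrite -row_free_unit -kermx_eq0; apply/eqP/row_matrixP => i.
rewrite row0; apply/eqP/negPn/negP => ki.
have kt : (row i (kermx (g p)))^T != 0.
  by apply: contra ki => /eqP /(congr1 trmx); rewrite trmxK trmx0 => ->.
have := metric_pos g p kt.
by rewrite /bilin trmxK -row_mul mulmx_ker row0 mul0mx mxE ltxx.
Qed.

Lemma form_endoP (Om : two_form X) p u v :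
  bilin (Om p) u v = bilin (g p) (form_endo Om p *m u) v.
Proof.
rewrite /bilin /form_endo !trmx_mul trmxK trmx_inv metric_sym.
by rewrite -!mulmxA (mulKmx (metric_unit p)).
Qed.

Section LeviCivita.
Variables (c : chart M n) (x : 'cV[R]_n).
Hypotheses (cX : atlas X c) (xc : chart_img c x).
Let G := form_in_chart X g c.

Let G_sym y : (G y)^T = G y.
Proof. by rewrite /G /form_in_chart !trmx_mul trmxK metric_sym mulmxA. Qed.

Let G_diff : differentiable G x.
Proof. by have [dG _] := metric_smooth g cX 1%N; exact: (dG x xc). Qed.

Let G_unit : G x \in unitmx.
Proof.
have [p cp <-] := xc.
have pE : chart_inv c (c p) = p by apply: chart_mapK; rewrite inE.
have J_unit : jac c (chart_at X p) p \in unitmx.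
  rewrite unitmxE unitfE gt_eqF //; apply: (atlas_oriented cX) => //.
  - exact: chart_at_atlas.
  - exact: chart_at_dom.
by rewrite /G /form_in_chart pE !unitmx_mul unitmx_tr J_unit metric_unit.
Qed.

Let DG_sym u : ('D_u G x)^T = 'D_u G x.
Proof.
have dG : derivable G x u by apply: diff_derivable.
apply/matrixP => i j; rewrite mxE.
rewrite !derive_mx //.
rewrite !mxE; congr ('D_u _ x); apply/funext => y.
by rewrite -{1}[G y]G_sym mxE.
Qed.

Lemma christoffel_koszul u v z :
  bilin (G x) (christoffel c x u v) z =
  2^-1 * (bilin ('D_u G x) v z + bilin ('D_v G x) u z - bilin ('D_z G x) u v).
Proof.
have zE : z = \sum_l z l 0 *: basisv l.
  by rewrite [LHS]matrix_sum_delta; apply: eq_bigr => l _; rewrite big_ord1.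
have bE (A : 'M[R]_n) y : bilin A y z = \sum_l z l 0 * bilin A y (basisv l).
  rewrite {1}zE /bilin mulmx_sumr summxE; apply: eq_bigr => l _.
  by rewrite -scalemxAr mxE.
have dE : bilin ('D_z G x) u v = \sum_l z l 0 * bilin ('D_(basisv l) G x) u v.
  rewrite deriveE // {1}zE linear_sum /bilin mulmx_sumr mulmx_suml summxE.
  apply: eq_bigr => l _.
  by rewrite linearZ /= -scalemxAr -scalemxAl mxE deriveE.
rewrite [X in _ = _ * (_ - X)]dE [X in _ = _ * (X + _ - _)]bE.
rewrite [X in _ = _ * (_ + X - _)]bE -big_split -sumrB mulr_sumr.
rewrite /bilin /christoffel -/G trmx_mul trmx_inv G_sym.
rewrite mulmxKV; last exact: G_unit.
rewrite mxE; apply: eq_bigr => l _.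
rewrite [(_^T : 'rV__) _ _]mxE [(\col_ _ _) _ _]mxE.
by rewrite /= -mulrA; congr (_ * _); rewrite mulrC mulrBr mulrDr.
Qed.

Lemma christoffel_torsion_free u v :
  christoffel c x u v = christoffel c x v u.
Proof.
have kE u' v' l : bilin ('D_(basisv l) G x) u' v' =
    bilin ('D_(basisv l) G x) v' u' by exact/bilin_sym/DG_sym.
rewrite /christoffel -/G; congr (_ *m _); apply/colP => l.
rewrite [LHS]mxE [RHS]mxE [X in _ * (_ - X) = _]kE.
by rewrite [X in _ * (X - _) = _]addrC.
Qed.

Lemma christoffel_metric u v z :
  bilin ('D_u G x) v z =
  bilin (G x) (christoffel c x u v) z + bilin (G x) v (christoffel c x u z).
Proof.
have sE : bilin ('D_u G x) z v = bilin ('D_u G x) v z.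
  exact/bilin_sym/DG_sym.
have GE : bilin (G x) v (christoffel c x u z) =
    bilin (G x) (christoffel c x u z) v by exact/bilin_sym/G_sym.
have alg (p q q' a a' b d : R) : p = 2^-1 * (a + b - d) ->
  q = 2^-1 * (a' + d - b) -> a' = a -> q' = q -> a = p + q' by lra.
exact: alg (christoffel_koszul u v z) (christoffel_koszul u z v) sE GE.
Qed.

End LeviCivita.

End Riemannian.

End Manifold.

Section FrameBundle.
Context {R : realType} {M : topologicalType} {n : nat}.
Context {X : @oriented_manifold R M n.+1}.
Variable g : riemannian_metric X.

(* A pair (p, A) stands for the linear map R^n -> T_pM with matrix A.  The
   frame bundle is the set FM of such pairs; functions on FM are functions on
   all pairs of which only the values on FM matter. *)
Definition frame : Type := (M * 'M[R]_n.+1)%type.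
Implicit Types (w : frame) (f : frame -> R).

Definition FM : set frame :=
  [set w | w.2^T *m g w.1 *m w.2 = 1%:M /\ 0 < \det w.2].

Definition frame_coord (c : chart M n.+1) w : 'M[R]_n.+1 :=
  jac (chart_at X w.1) c w.1 *m w.2.

(* f is smooth on a neighbourhood of w in FM: in coordinates it is there the
   restriction of a smooth function on an open set of R^n x M_n(R). *)
Definition smooth_near f w : Prop :=
  exists c, [/\ atlas X c, chart_dom c w.1 &
    exists (V : set ('cV[R]_n.+1 * 'M[R]_n.+1))
           (F : 'cV[R]_n.+1 * 'M[R]_n.+1 -> R),
      [/\ open V, V (c w.1, frame_coord c w), smooth_on V F &
          forall w', FM w' -> chart_dom c w'.1 ->
            V (c w'.1, frame_coord c w') ->
            f w' = F (c w'.1, frame_coord c w')]].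

(* Vector fields on FM are derivations: Z f w is the derivative of f at w. *)
Definition vfield : Type := (frame -> R) -> frame -> R.

Definition vfield_eq (Z Z' : vfield) : Prop :=
  forall f w, FM w -> smooth_near f w -> Z f w = Z' f w.

Definition vfield_bracket (Z Z' : vfield) : vfield :=
  fun f w => Z (Z' f) w - Z' (Z f) w.

Definition right_action (a : 'M[R]_n.+1) w : frame := (w.1, w.2 *m a).

Definition expmx (A : 'M[R]_n.+1) : 'M[R]_n.+1 :=
  lim (series (fun k : nat => (k`!%:R)^-1 *: A ^+ k) @ \oo).

Definition vert (xi : 'M[R]_n.+1) : vfield :=
  fun f w => derive1 (fun t : R => f (right_action (expmx (t *: xi)) w)) 0.

(* Y_Xi for a function Xi : FM -> so(n) *)
Definition vert_fun (Xi : frame -> 'M[R]_n.+1) : vfield :=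
  fun f w => \sum_(i < n.+1) \sum_(j < n.+1 | (i < j)%N)
    so_dot (Xi w) (wedge (basisv i) (basisv j)) *
    vert (wedge (basisv i) (basisv j)) f w.

(* c is a curve in FM through w at t = 0 whose velocity there is the horizontal
   lift of u : T_pM, i.e. its projection to M has velocity u, and for each z the
   vector field t |-> c(t) z along the projection has zero covariant derivative
   at t = 0. *)
Definition horizontal_curve w (u : 'cV[R]_n.+1) (c : R -> frame) : Prop :=
  let k := chart_at X w.1 in
  [/\ c 0 = w,
      \forall t \near (0 : R), FM (c t) /\ chart_dom k (c t).1,
      is_derive (0 : R) 1 (fun t => k (c t).1) u &
      exists2 A, is_derive (0 : R) 1 (fun t => frame_coord k (c t)) A &
        forall z, A *m z + christoffel g k (k w.1) u (w.2 *m z) = 0].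

(* B_x f (w): derivative of f along the horizontal lift of w(x); for f smooth
   near w it does not depend on the curve. *)
Definition horiz (x : 'cV[R]_n.+1) : vfield :=
  fun f w => xget 0 [set l : R | exists2 c, horizontal_curve w (w.2 *m x) c &
                                   is_derive (0 : R) 1 (f \o c) l].

Definition horiz_mx (x : 'cV[R]_n.+1) (T : frame -> 'M[R]_n.+1) w :
  'M[R]_n.+1 := \matrix_(i, j) horiz x (fun w' => T w' i j) w.

Definition curvature_mx (x y : 'cV[R]_n.+1) w : 'M[R]_n.+1 :=
  \matrix_(i, j) (invmx w.2 *m
    curvature g w.1 (w.2 *m x) (w.2 *m y) (w.2 *m basisv j)) i 0.

Section Magnetic.
Variable Om : two_form X.

Definition e1 : 'cV[R]_n.+1 := basisv ord0.

Definition perp (x : 'cV[R]_n.+1) : 'cV[R]_n.+1 := x - dot x e1 *: e1.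

Definition bOm w : 'M[R]_n.+1 := invmx w.2 *m form_endo g Om w.1 *m w.2.

Definition bOm0 w : 'M[R]_n.+1 :=
  2^-1 *: (bOm w - wedge e1 (bOm w *m e1)).

Definition tOm w : 'M[R]_n.+1 := wedge e1 (bOm w *m e1) + bOm0 w.

Definition magnetic_field : vfield :=
  fun f w => horiz e1 f w + vert_fun tOm f w.

Definition mag_horiz_basis (i : 'I_n.+1) : vfield :=
  if i == ord0 then magnetic_field
  else fun f w => - vfield_bracket magnetic_field
                      (vert (wedge e1 (basisv i))) f w.

(* B^Omega_x for a function x : FM -> R^n *)
Definition mag_horiz (x : frame -> 'cV[R]_n.+1) : vfield :=
  fun f w => \sum_(i < n.+1) dot (x w) (basisv i) * mag_horiz_basis i f w.

Definition is_contorsion (T : 'cV[R]_n.+1 -> frame -> 'M[R]_n.+1) : Prop :=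
  forall x, (forall w, FM w -> skew (T x w)) /\
    vfield_eq (mag_horiz (cst x))
              (fun f w => horiz x f w - vert_fun (T x) f w).

Definition is_torsion_curvature
    (tau : 'cV[R]_n.+1 -> 'cV[R]_n.+1 -> frame -> 'cV[R]_n.+1)
    (RO : 'cV[R]_n.+1 -> 'cV[R]_n.+1 -> frame -> 'M[R]_n.+1) : Prop :=
  forall x y, (forall w, FM w -> skew (RO x y w)) /\
    vfield_eq
      (fun f w => - vfield_bracket (mag_horiz (cst x)) (mag_horiz (cst y)) f w)
      (fun f w => mag_horiz (tau x y) f w + vert_fun (RO x y) f w).

End Magnetic.

End FrameBundle.

(* Main.v *)
(** In the coordinates [(x, A)] given on the frame bundle by a chart, with
    [C(u)] the Christoffel matrix, [B_x] is the derivative in the direction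
    [(A x, - C(A x) A)] and [Y_xi] the one in the direction [(0, A xi)].
    Testing the definition of the contorsion on the entries of [A] gives
      [T_x = - 1/2 (<x, e1> Omega + e1 /\ Omega x + x_perp /\ Omega e1)],
    so [B^Omega_x] is the direction
    [m_x = (A x, - C(A x) A - A T_x)].  Testing [- [B^Omega_x, B^Omega_y]] on
    the coordinates of the base point gives [tau = T_x y - T_y x], and testing
    it on the entries of [A], which involves only first derivatives of [m_x],
    gives
      [R^Omega(x, y) = R(x, y) + B_x T_y - B_y T_x
         + T_tau - [T_x, T_y] - Y_{T_x} T_y + Y_{T_y} T_x].
    Since [Y_xi Omega = [Omega, xi]], the last four terms are algebraic in
    [Omega].  The definition of [B_x] at a frame uses the preferred chart of its
    base point; passing to a fixed chart is the transformation law of the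
    Christoffel symbols. *)
Require Import Defs.
From HB Require Import structures.
From mathcomp Require Import all_boot all_order all_algebra.
From mathcomp Require Import ring lra.
From mathcomp Require Import all_classical all_reals all_analysis.

Set Implicit Arguments.
Unset Strict Implicit.
Unset Printing Implicit Defensive.

Import Order.TTheory GRing.Theory Num.Theory.
Import numFieldNormedType.Exports.

Local Open Scope classical_set_scope.
Local Open Scope ring_scope.

(** * Directional derivatives and smooth functions *)

(** Values of a function off [FM] are arbitrary, and [FM] is not open in the space of pairs (x, A),
    so a field can be computed only along curves that stay in [FM]. For [B_x] such a curve must be
    exhibited, since [horiz] takes a default value where there is none: the straight line in
    coordinates with the right velocity leaves [FM], but its Gram matrix is constant to first order,
    so it can be orthonormalized without changing its velocity. A bracket applies one field to the
    derivative along another, hence needs that derivative as an explicit function at all nearby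
    frames. This forces one chart to be used for all of them, whereas the preferred charts may
    change from point to point without any regularity. It also restricts the test functions: on the
    coordinates x and A the derivative along [m_x] is explicit, and a direction is determined by its
    effect on them. On other functions the fields defined by brackets are never expanded; the
    defining property of the contorsion gives their value. *)

Section DirectionalDerivatives.
Context {R : realType} {V : normedModType R}.
Implicit Types (x v : V).

Lemma is_derive_mxP m n (M : V -> 'M[R]_(m, n)) x v D :
  is_derive x v M D <->
  forall i j, is_derive x v (fun y => M y i j) (D i j).
Proof.
split=> [[dM <-] i j|dM].
  have dMij := (derivable_mxP M x v).1 dM i j.
  by apply: DeriveDef => //; rewrite derive_mx // mxE.
have dM' : derivable M x v.
  by apply/derivable_mxP => i j; have [] := dM i j.
apply: DeriveDef => //; rewrite derive_mx //.
by apply/matrixP => i j; rewrite mxE; have [_ ->] := dM i j.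
Qed.

Lemma is_derive_sum_in (W : normedModType R) (I : Type) (s : seq I)
    (P : pred I) (f : I -> V -> W) (d : I -> W) x v :
  (forall i, P i -> is_derive x v (f i) (d i)) ->
  is_derive x v (fun y => \sum_(i <- s | P i) f i y) (\sum_(i <- s | P i) d i).
Proof.
move=> df; elim: s => [|i s IH].
  rewrite big_nil (_ : (fun _ => _) = cst 0); first exact: is_derive_cst.
  by apply/funext => y; rewrite big_nil.
rewrite big_cons (_ : (fun _ => _) = (fun y => (if P i then f i y else 0) +
    \sum_(j <- s | P j) f j y)); last first.
  by apply/funext => y; rewrite big_cons; case: ifP => // _; rewrite add0r.
case: ifPn => Pi; first exact: (is_deriveD (df _ Pi) IH).
by rewrite (_ : (fun _ => _) = fun y => \sum_(j <- s | P j) f j y) //;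
  apply/funext => y; rewrite add0r.
Qed.

Lemma is_derive_mulmx m n p (A : V -> 'M[R]_(m, n)) (B : V -> 'M[R]_(n, p))
    x v dA dB :
  is_derive x v A dA -> is_derive x v B dB ->
  is_derive x v (fun y => A y *m B y) (dA *m B x + A x *m dB).
Proof.
move=> /is_derive_mxP hA /is_derive_mxP hB; apply/is_derive_mxP => i j.
rewrite (_ : (fun _ => _) = fun y => \sum_k A y i k * B y k j); last first.
  by apply/funext => y; rewrite mxE.
rewrite !mxE -big_split /=; apply: is_derive_sum_in => k _.
apply: (is_derive_eq (is_deriveM (hA i k) (hB k j))).
by rewrite addrC; congr (_ + _); exact: mulrC.
Qed.

Lemma is_derive_tr m n (A : V -> 'M[R]_(m, n)) x v dA :
  is_derive x v A dA -> is_derive x v (fun y => (A y)^T) dA^T.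
Proof.
move=> /is_derive_mxP hA; apply/is_derive_mxP => i j; rewrite mxE.
by rewrite (_ : (fun _ => _) = fun y => A y j i) //; apply/funext => y; rewrite mxE.
Qed.

Lemma is_derive_scale (W : normedModType R) (f : V -> R) (A : W) x v df :
  is_derive x v f df -> is_derive x v (fun y => f y *: A) (df *: A).
Proof.
move=> [hf <-]; rewrite /derivable /derive.
have E : (fun h : R => h^-1 *: (f (h *: v + x) *: A - f x *: A)) =
    (fun h : R => (h^-1 *: (f (h *: v + x) - f x)) *: A).
  by apply/funext => h; rewrite -scalerBl !scalerA.
have C : (h^-1 *: (f (h *: v + x) *: A - f x *: A)) @[h --> 0^'] -->
    'D_v f x *: A by rewrite E; apply: cvgZr_tmp.
by split; [apply/cvg_ex; exists ('D_v f x *: A)|apply: cvg_lim].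
Qed.

(** The inner map is only known to have a derivative in the direction [v]. Its restriction to the
    line through [x] is a function of one real variable, where having a derivative is the same as
    being differentiable, so the chain rule for differentials applies. *)
Lemma is_derive_chain (W Z : normedModType R) (f : W -> Z) (c : V -> W) x v dc :
  differentiable f (c x) -> is_derive x v c dc ->
  is_derive x v (f \o c) ('D_dc f (c x)).
Proof.
move=> df [hc hd].
pose l (h : R) := h *: v + x; pose cl := c \o l.
have l0 : l 0 = x by rewrite /l scale0r add0r.
have clE : cl 0 = c x by rewrite /cl /= l0.
have hcl : derivable cl 0 1 := (derivable1P c x v).1 hc.
have dcl : differentiable cl 0 by apply/derivable1_diffP.
have dfl : differentiable f (cl 0) by rewrite clE.
have dfc : differentiable (f \o cl) 0 by apply: differentiable_comp.
have DE (W' : normedModType R) (h : V -> W') : 'D_v h x = 'D_1 (h \o l) 0.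
  rewrite /derive; congr (lim (_ @ 0^')); apply/funext => t /=.
  by rewrite addr0 l0 /l [t *: 1]mulr1.
have fcv : derivable (f \o c) x v.
  by apply: (derivable1P _ x v).2; apply/derivable1_diffP.
apply: DeriveDef => //.
rewrite DE -/cl compA -/cl (deriveE _ dfc) diff_comp //= clE.
by rewrite -hd DE -/cl (deriveE _ dcl) deriveE.
Qed.

Lemma is_derive_pair (W Z : normedModType R) (f : V -> W) (h : V -> Z)
    x v df dh :
  is_derive x v f df -> is_derive x v h dh ->
  is_derive x v (fun y => (f y, h y)) (df, dh).
Proof.
move=> [cf <-] [ch <-].
have C : (h0^-1 *: ((f (h0 *: v + x), h (h0 *: v + x)) - (f x, h x)))
    @[h0 --> 0^'] --> ('D_v f x, 'D_v h x) by apply: cvg_pair.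
split; first by apply/cvg_ex; eexists; exact: C.
by apply: cvg_lim.
Qed.

Lemma is_derive_lin (W : normedModType R) (f : {linear V -> W}) x v :
  continuous f -> is_derive x v f (f v).
Proof.
move=> cf; have df : differentiable f x by apply: linear_differentiable.
by apply: DeriveDef; [exact: diff_derivable|rewrite deriveE // diff_lin].
Qed.

End DirectionalDerivatives.

Section SmoothAlgebra.
Context {R : realType} {V : normedModType R}.
Implicit Types (U : set V) (f g : V -> R).

(** The first-order expansion of [f] at [x] is also one of [g], and a continuous linear map with
    this property is the differential. *)
Lemma near_eq_differentiable (W : normedModType R) (f g : V -> W) x :
  (\near x, f x = g x) -> differentiable f x -> differentiable g x.
Proof.
move=> fg df; apply/diff_locallyP.
have fgx : f x = g x := nbhs_singleton fg.
have key : g \o shift x = cst (g x) + 'd f x +o_ 0 id.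
  apply/eqaddoP => _/posnumP[e].
  have /diff_locally/eqaddoP/(_ e%:num)/(_ (gt0 _)) H := df.
  have fg0 : \forall y \near (0 : V), f (y + x) = g (y + x).
    by move: fg; rewrite (near_shift 0) /=; apply: filterS => y /=; rewrite subr0.
  by apply: filterS2 fg0 H => y; rewrite !fctE /= fgx => ->.
have cf : continuous ('d f x : V -> W) := diff_continuous df.
by have -> := diff_unique cf key.
Qed.

(** On an open set, equality on the set is equality near each of its points, so it passes to
    derivatives of every order. *)
Lemma times_differentiable_ext (W : normedModType R) k U (f g : V -> W) :
  open U -> (forall x, U x -> f x = g x) ->
  times_differentiable k U f -> times_differentiable k U g.
Proof.
move=> oU; elim: k f g => //= k IH f g fg [df Df].
have nfg x : U x -> \near x, f x = g x.
  by move=> Ux; apply: filterS fg _; exact: open_nbhs_nbhs.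
split=> [x Ux|v]; first exact: near_eq_differentiable (nfg _ Ux) (df _ Ux).
apply: IH (Df v) => x Ux; exact: near_eq_derive (nfg _ Ux).
Qed.

Lemma times_differentiableS (W : normedModType R) k U (f : V -> W) :
  times_differentiable k.+1 U f -> times_differentiable k U f.
Proof.
elim: k f => //= k IH f [df Df]; split=> // v.
by apply: IH; exact: Df.
Qed.

Lemma smooth_on_ext (W : normedModType R) U (f g : V -> W) :
  open U -> (forall x, U x -> f x = g x) -> smooth_on U f -> smooth_on U g.
Proof. by move=> oU fg sf k; exact: times_differentiable_ext fg (sf k). Qed.

Lemma smooth_on_differentiable (W : normedModType R) U (f : V -> W) x :
  smooth_on U f -> U x -> differentiable f x.
Proof. by move=> /(_ 1%N) [df _]; exact: df. Qed.

Lemma smooth_on_derive (W : normedModType R) U (f : V -> W) v :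
  smooth_on U f -> smooth_on U ('D_v f).
Proof. by move=> sf k; have [_] := sf k.+1; exact. Qed.

Lemma smooth_on_cst (W : normedModType R) U (a : W) :
  smooth_on U (fun _ : V => a).
Proof.
move=> k; elim: k a => //= k IH a; split=> [x _|v]; first exact: differentiable_cst.
have -> : 'D_v (fun _ : V => a) = fun=> 0 by apply/funext => x; exact: derive_cst.
exact: IH.
Qed.

Lemma smooth_on_lin (W : normedModType R) U (f : {linear V -> W}) :
  continuous f -> smooth_on U f.
Proof.
move=> cf [|k] //=; split=> [x _|v]; first exact: linear_differentiable.
have -> : 'D_v f = fun=> f v.
  by apply/funext => x; have [_] := is_derive_lin x v cf.
exact: smooth_on_cst.
Qed.

Lemma times_differentiableD (W : normedModType R) k U (f g : V -> W) : open U ->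
  times_differentiable k U f -> times_differentiable k U g ->
  times_differentiable k U (fun x => f x + g x).
Proof.
move=> oU; elim: k f g => //= k IH f g [df Df] [dg Dg]; split=> [x Ux|v].
  by apply: differentiableD; [exact: df|exact: dg].
apply: times_differentiable_ext (IH _ _ (Df v) (Dg v)) => // x Ux.
by rewrite -deriveD //; apply: diff_derivable; [exact: df|exact: dg].
Qed.

Lemma times_differentiableM k U f g : open U ->
  times_differentiable k U f -> times_differentiable k U g ->
  times_differentiable k U (fun x => f x * g x).
Proof.
move=> oU; elim: k f g => //= k IH f g [df Df] [dg Dg]; split=> [x Ux|v].
  by apply: (@differentiableM _ _ f g); [exact: df|exact: dg].
(* The Leibniz rule multiplies [f] by a derivative of [g], which has one order less; the induction
   hypothesis asks for both at order [k]. *)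
have tf : times_differentiable k U f by apply: times_differentiableS; split.
have tg : times_differentiable k U g by apply: times_differentiableS; split.
have h := times_differentiableD oU (IH _ _ tf (Dg v)) (IH _ _ tg (Df v)).
apply: times_differentiable_ext h => // x Ux.
by rewrite (@deriveM _ _ f g) //;
  apply: diff_derivable; [exact: df|exact: dg].
Qed.

Lemma smooth_onD (W : normedModType R) U (f g : V -> W) : open U ->
  smooth_on U f -> smooth_on U g -> smooth_on U (fun x => f x + g x).
Proof. by move=> oU sf sg k; exact: times_differentiableD. Qed.

Lemma smooth_onM U f g : open U ->
  smooth_on U f -> smooth_on U g -> smooth_on U (fun x => f x * g x).
Proof. by move=> oU sf sg k; exact: times_differentiableM. Qed.

Lemma smooth_onN U f : open U ->
  smooth_on U f -> smooth_on U (fun x => - f x).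
Proof.
move=> oU sf; apply: (@smooth_on_ext _ _ (fun x => -1 * f x)) => //.
  by move=> x _; rewrite mulN1r.
by apply: smooth_onM => //; exact: smooth_on_cst.
Qed.

Lemma smooth_on_sum U (I : Type) (s : seq I) (P : pred I) (F : I -> V -> R) :
  open U -> (forall i, P i -> smooth_on U (F i)) ->
  smooth_on U (fun x => \sum_(i <- s | P i) F i x).
Proof.
move=> oU sF; elim: s => [|i s IH].
  apply: smooth_on_ext (smooth_on_cst U (0 : R)) => // x _.
  by rewrite big_nil.
case: (boolP (P i)) => Pi; last first.
  by apply: smooth_on_ext IH => // x _; rewrite big_cons (negbTE Pi).
apply: smooth_on_ext (smooth_onD oU (sF _ Pi) IH) => // x _.
by rewrite big_cons Pi.
Qed.

Lemma smooth_on_prod U (I : Type) (s : seq I) (P : pred I) (F : I -> V -> R) :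
  open U -> (forall i, P i -> smooth_on U (F i)) ->
  smooth_on U (fun x => \prod_(i <- s | P i) F i x).
Proof.
move=> oU sF; elim: s => [|i s IH].
  apply: smooth_on_ext (smooth_on_cst U (1 : R)) => // x _.
  by rewrite big_nil.
case: (boolP (P i)) => Pi; last first.
  by apply: smooth_on_ext IH => // x _; rewrite big_cons (negbTE Pi).
apply: smooth_on_ext (smooth_onM oU (sF _ Pi) IH) => // x _.
by rewrite big_cons Pi.
Qed.

(** The derivative of 1/f is that of f times - f^-2, so order [k.+1] for the inverse reduces to
    order [k] for the inverse itself and for a derivative of [f]. *)
Lemma smooth_onV U f : open U -> (forall x, U x -> f x != 0) ->
  smooth_on U f -> smooth_on U (fun x => (f x)^-1).
Proof.
move=> oU f0 sf; elim=> //= k IH; split=> [x Ux|v].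
  apply: differentiableV; last exact: f0.
  exact: smooth_on_differentiable sf Ux.
have dg : times_differentiable k U (fun x => (-1 * (f x)^-1) * (f x)^-1 * 'D_v f x).
  apply: times_differentiableM (smooth_on_derive v sf k) => //.
  apply: times_differentiableM (IH) => //.
  by apply: times_differentiableM (IH) => //; exact: smooth_on_cst.
apply: times_differentiable_ext dg => // x Ux.
rewrite deriveV ?f0 //; last first.
  by apply: diff_derivable; exact: smooth_on_differentiable sf Ux.
by rewrite /GRing.scale /= mulN1r mulNr -expr2 exprVn.
Qed.

End SmoothAlgebra.

(** * Smooth matrix functions and symmetry of second derivatives *)

Section SmoothMatrices.
Context {R : realType} {V : normedModType R}.
Implicit Types (U : set V).

(** Smoothness is taken entry by entry so that products, determinants and inverses reduce to sums
    and products of scalar functions. *)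
Definition smooth_mx_on m n U (M : V -> 'M[R]_(m, n)) :=
  forall i j, smooth_on U (fun x => M x i j).

Lemma smooth_on_mx m n U (M : V -> 'M[R]_(m, n)) : open U ->
  smooth_on U M -> smooth_mx_on U M.
Proof.
move=> oU sM i j k; move: (sM k); elim: k M {sM} => //= k IH M [dM DM].
split=> [x Ux|v].
  by apply: (@differentiable_comp _ _ _ _ M (fun A : 'M[R]_(m, n) => A i j));
    [exact: dM|exact: differentiable_coord].
apply: times_differentiable_ext (IH _ (DM v)) => // x Ux.
by rewrite derive_mx ?mxE //; apply: diff_derivable; exact: dM.
Qed.

Lemma smooth_mx_mul m n p U (A : V -> 'M[R]_(m, n)) (B : V -> 'M[R]_(n, p)) :
  open U -> smooth_mx_on U A -> smooth_mx_on U B ->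
  smooth_mx_on U (fun x => A x *m B x).
Proof.
move=> oU sA sB i j.
apply: (@smooth_on_ext _ _ _ _ (fun x => \sum_k A x i k * B x k j)) => //.
  by move=> x _; rewrite mxE.
by apply: smooth_on_sum => // k _; exact: smooth_onM.
Qed.

Lemma smooth_mx_add m n U (A B : V -> 'M[R]_(m, n)) : open U ->
  smooth_mx_on U A -> smooth_mx_on U B -> smooth_mx_on U (fun x => A x + B x).
Proof.
move=> oU sA sB i j.
apply: (@smooth_on_ext _ _ _ _ (fun x => A x i j + B x i j)) => //.
  by move=> x _; rewrite mxE.
exact: smooth_onD.
Qed.

Lemma smooth_mx_scale m n U (f : V -> R) (A : V -> 'M[R]_(m, n)) : open U ->
  smooth_on U f -> smooth_mx_on U A -> smooth_mx_on U (fun x => f x *: A x).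
Proof.
move=> oU sf sA i j.
apply: (@smooth_on_ext _ _ _ _ (fun x => f x * A x i j)) => //.
  by move=> x _; rewrite mxE.
exact: smooth_onM.
Qed.

Lemma smooth_mx_opp m n U (A : V -> 'M[R]_(m, n)) : open U ->
  smooth_mx_on U A -> smooth_mx_on U (fun x => - A x).
Proof.
move=> oU sA i j.
apply: (@smooth_on_ext _ _ _ _ (fun x => - A x i j)) => //.
  by move=> x _; rewrite mxE.
exact: smooth_onN.
Qed.

Lemma smooth_mx_sum m n U (I : Type) (s : seq I) (P : pred I)
    (F : I -> V -> 'M[R]_(m, n)) : open U ->
  (forall i, P i -> smooth_mx_on U (F i)) ->
  smooth_mx_on U (fun x => \sum_(i <- s | P i) F i x).
Proof.
move=> oU sF i j.
apply: (@smooth_on_ext _ _ _ _ (fun x => \sum_(k <- s | P k) F k x i j)) => //.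
  by move=> x _; rewrite summxE.
by apply: smooth_on_sum => // k Pk; exact: sF.
Qed.

Lemma smooth_mx_cst m n U (A : 'M[R]_(m, n)) : smooth_mx_on U (fun=> A).
Proof. by move=> i j; exact: smooth_on_cst. Qed.

Lemma smooth_mx_tr m n U (A : V -> 'M[R]_(m, n)) : open U ->
  smooth_mx_on U A -> smooth_mx_on U (fun x => (A x)^T).
Proof.
move=> oU sA i j; apply: smooth_on_ext (sA j i) => // x _.
by rewrite mxE.
Qed.

Lemma smooth_on_det n U (A : V -> 'M[R]_n) : open U ->
  smooth_mx_on U A -> smooth_on U (fun x => \det (A x)).
Proof.
move=> oU sA; apply: smooth_on_sum => // s _; apply: smooth_onM => //.
  exact: smooth_on_cst.
by apply: smooth_on_prod => // i _; exact: sA.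
Qed.

(** Cramer's formula: cofactors and determinant are polynomials in the entries. *)
Lemma smooth_mx_inv n U (A : V -> 'M[R]_n) : open U ->
  (forall x, U x -> A x \in unitmx) ->
  smooth_mx_on U A -> smooth_mx_on U (fun x => invmx (A x)).
Proof.
move=> oU uA sA i j.
apply: (@smooth_on_ext _ _ _ _
    (fun x => (\det (A x))^-1 * cofactor (A x) j i)) => //.
  by move=> x Ux; rewrite /invmx uA // !mxE.
apply: smooth_onM => //.
  apply: smooth_onV => //; last exact: smooth_on_det.
  by move=> x Ux; rewrite -unitfE -unitmxE uA.
apply: smooth_onM => //; first exact: smooth_on_cst.
apply: smooth_on_det => // k l.
by apply: smooth_on_ext (sA _ _) => // x _; rewrite !mxE.
Qed.

End SmoothMatrices.

(** The derivative of [f \o L] along [v] is the derivative of [f] along [L v], composed with [L], so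
    the induction stays among compositions with [L]. *)
Lemma smooth_on_comp_lin (R : realType) (E V W : normedModType R) (U : set V)
    (f : V -> W) (L : {linear E -> V}) : continuous L -> open U ->
  smooth_on U f -> smooth_on (L @^-1` U) (f \o L).
Proof.
move=> cL oU sf k; move: (sf k); elim: k f {sf} => //= k IH f [df Df].
have oLU : open (L @^-1` U) by apply: open_comp => // x _; exact: cL.
split=> [x Ux|v].
  apply: differentiable_comp; last exact: df.
  exact: linear_differentiable.
apply: times_differentiable_ext (IH _ (Df (L v))) => // x Ux /=.
by have [_ <-] := is_derive_chain (df _ Ux) (is_derive_lin x v cL).
Qed.

Section SecondDerivatives.
Context {R : realType} {V : normedModType R}.
Implicit Types (f : V -> R).

Lemma derive_line f (x u : V) (t : R) : differentiable f (x + t *: u) ->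
  is_derive t 1 (fun s => f (x + s *: u)) ('D_u f (x + t *: u)).
Proof.
move=> df.
have dl : is_derive t 1 (fun s : R => x + s *: u) u.
  have h := is_derive_scale u (is_derive_id t 1).
  by have := is_deriveD (is_derive_cst x t 1) h; rewrite add0r scale1r.
exact: (is_derive_chain (c := fun s : R => x + s *: u) df dl).
Qed.

(** The mean value theorem is used twice: along [u], for the increment of [f] under the shift by
    [s *: v], and along [v], for the derivative of [f] along [u]. *)
Lemma second_difference f (x u v : V) (s : R) : 0 < s ->
  (forall a b : R, 0 <= a <= s -> 0 <= b <= s ->
     differentiable f (x + a *: u + b *: v)) ->
  (forall a b : R, 0 <= a <= s -> 0 <= b <= s ->
     differentiable ('D_u f) (x + a *: u + b *: v)) ->
  exists a b, [/\ 0 <= a <= s, 0 <= b <= s &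
    f (x + s *: u + s *: v) - f (x + s *: u) - f (x + s *: v) + f x =
    'D_v ('D_u f) (x + a *: u + b *: v) * s ^+ 2].
Proof.
move=> s0 df Df.
have in0 : 0 <= (0 : R) <= s by rewrite lexx ltW.
have ins : 0 <= s <= s by rewrite lexx ltW.
pose h a := f (x + s *: v + a *: u) - f (x + a *: u).
have dh a : 0 <= a <= s ->
    is_derive a 1 h ('D_u f (x + s *: v + a *: u) - 'D_u f (x + a *: u)).
  move=> ha; apply: is_deriveB; apply: derive_line.
    by rewrite -addrA [_ *: v + _]addrC addrA; exact: df.
  by rewrite -[_ + _ *: u]addr0 -(scale0r v); exact: df.
have [||a] := @MVT_segment _ h
    (fun a => 'D_u f (x + s *: v + a *: u) - 'D_u f (x + a *: u)) 0 s (ltW s0).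
- by move=> a; rewrite in_itv /= => /andP[a0 as_]; apply: dh; rewrite !ltW.
- apply: derivable_within_continuous => a; rewrite in_itv /= => /dh[].
  by [].
rewrite in_itv /= subr0 => ha hE.
have dk b : 0 <= b <= s ->
    is_derive b 1 (fun b => 'D_u f (x + a *: u + b *: v))
      ('D_v ('D_u f) (x + a *: u + b *: v)).
  by move=> hb; apply: derive_line; exact: Df.
have [||b] := @MVT_segment _ (fun b => 'D_u f (x + a *: u + b *: v))
    (fun b => 'D_v ('D_u f) (x + a *: u + b *: v)) 0 s (ltW s0).
- by move=> b; rewrite in_itv /= => /andP[b0 bs]; apply: dk; rewrite !ltW.
- apply: derivable_within_continuous => b; rewrite in_itv /= => /dk[].
  by [].
rewrite in_itv /= subr0 => hb kE.
exists a, b; split=> //.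
rewrite expr2 mulrA -kE scale0r addr0.
rewrite -[X in _ - 'D_u f X]addr0 in hE.
move: hE; rewrite /h !scale0r !addr0 => hE.
rewrite [x + a *: u + s *: v]addrAC -hE addrAC [x + s *: u + _]addrAC.
by rewrite opprB addrA.
Qed.

Let sub_swap (a b c d : R) : a - b - c + d = a - c - b + d.
Proof. by ring. Qed.

Let dist_le_trans (P Q a b e : R) : `|P - a| < e / 2 -> `|Q - b| < e / 2 ->
  b = a -> `|P - Q| <= e.
Proof.
move=> h1 h2 ba; rewrite (le_trans (ler_distD a P Q)) // [e]splitr.
by rewrite lerD ?(ltW h1) // -ba distrC ltW.
Qed.

(** The second difference is symmetric in [u] and [v], so each mixed derivative takes, arbitrarily
    close to [x], a value that the other one also takes close to [x]; both are continuous at [x]. *)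
Lemma derive_swap f (U : set V) x u v : open U -> U x -> smooth_on U f ->
  'D_u ('D_v f) x = 'D_v ('D_u f) x.
Proof.
move=> oU Ux sf.
have cf a b : {for x, continuous ('D_a ('D_b f))}.
  apply: differentiable_continuous.
  by apply: smooth_on_differentiable Ux; do 2!apply: smooth_on_derive.
apply/eqP; rewrite -subr_eq0 -normr_le0; apply/ler_addgt0Pl => e e0.
rewrite addr0.
pose W := [set y | [/\ U y, `|'D_u ('D_v f) x - 'D_u ('D_v f) y| < e / 2 &
   `|'D_v ('D_u f) x - 'D_v ('D_u f) y| < e / 2]].
have nW : nbhs x W.
  have e2 : 0 < e / 2 by rewrite divr_gt0.
  have c1 : \forall y \near x, `|'D_u ('D_v f) x - 'D_u ('D_v f) y| < e / 2.
    exact: (cvgrPdist_lt _ _).1 (cf u v : _ @ _ --> _) _ e2.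
  have c2 : \forall y \near x, `|'D_v ('D_u f) x - 'D_v ('D_u f) y| < e / 2.
    exact: (cvgrPdist_lt _ _).1 (cf v u : _ @ _ --> _) _ e2.
  have oUx : nbhs x U by exact: open_nbhs_nbhs.
  by apply: filterS3 c1 c2 oUx => y h1 h2 h3; split.
have [r /= r0 rW] := (nbhs_ballP _ _).1 nW.
(* With [s * N = r / 2] the parallelogram of sides [s *: u] and [s *: v] lies in the ball of radius
   [r]; the summand 1 keeps [N] positive when both vectors vanish. *)
pose N := `|u| + `|v| + 1.
have N0 : 0 < N by rewrite ltr_wpDl // addr_ge0.
pose s := r / 2 / N.
have s0 : 0 < s by rewrite !divr_gt0.
have inW a b : 0 <= a <= s -> 0 <= b <= s -> W (x + a *: u + b *: v).
  move=> /andP[a0 as_] /andP[b0 bs]; apply: rW; rewrite -ball_normE /=.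
  rewrite -addrA opprD addNKr normrN (le_lt_trans (ler_normD _ _)) //.
  rewrite !normrZ !ger0_norm //.
  have H : a * `|u| + b * `|v| <= s * N.
    rewrite /N mulrDr mulr1 ler_wpDr ?(ltW s0) // mulrDr.
    by rewrite lerD // ler_wpM2r.
  apply: le_lt_trans H _; rewrite /s divfK ?gt_eqF //.
  by rewrite ltr_pdivrMr // ltr_pMr // ltr1n.
have dW y g : smooth_on U g -> W y -> differentiable g y.
  by move=> sg [Uy _ _]; apply: smooth_on_differentiable Uy.
have [a [b [ha hb E1]]] := @second_difference f x u v s s0
  (fun a b ha hb => dW _ _ _ sf (inW a b ha hb))
  (fun a b ha hb => dW _ _ _ (smooth_on_derive u sf) (inW a b ha hb)).
have inW' a' b' : 0 <= a' <= s -> 0 <= b' <= s -> W (x + a' *: v + b' *: u).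
  by move=> ? ?; rewrite addrAC; exact: inW.
have [a' [b' [ha' hb' E2]]] := @second_difference f x v u s s0
  (fun a b ha hb => dW _ _ _ sf (inW' a b ha hb))
  (fun a b ha hb => dW _ _ _ (smooth_on_derive v sf) (inW' a b ha hb)).
have E : 'D_v ('D_u f) (x + a *: u + b *: v) =
         'D_u ('D_v f) (x + a' *: v + b' *: u).
  apply: (mulIf (expf_neq0 2 (lt0r_neq0 s0))).
  rewrite [x + s *: v + _]addrAC in E2.
  exact: etrans (esym E1) (etrans (sub_swap _ _ _ _) E2).
have [_ _ h1] := inW _ _ ha hb; have [_ h2 _] := inW' _ _ ha' hb'.
exact: dist_le_trans h2 h1 E.
Qed.

End SecondDerivatives.

(** * The exponential of a skew matrix *)

Section MatrixExponential.
Context {R : realType} {n : nat}.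
Implicit Types (A : 'M[R]_n.+1) (c : R^nat) (t : R).

(** A majorant by an exponential series. It survives termwise differentiation, so one estimate gives
    the convergence of a power series and of its first two derived series, as the theorem on
    termwise differentiation requires. *)
Definition exp_bounded (D C : R) c :=
  [/\ 0 <= D, 0 <= C & forall k, `|c k| <= D * C ^+ k / k`!%:R].

Lemma exp_bounded_diffs D C c : exp_bounded D C c ->
  exp_bounded (D * C) C (pseries_diffs c).
Proof.
move=> [D0 C0 cb]; split=> // [|k]; first exact: mulr_ge0.
rewrite /pseries_diffs normrM ger0_norm //.
apply: le_trans (ler_wpM2l _ (cb k.+1)) _ => //.
rewrite factS natrM le_eqVlt; apply/orP; left; apply/eqP.
have f0 : (k`!%:R : R) != 0 by rewrite pnatr_eq0 -lt0n fact_gt0.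
have k0 : (k.+1%:R : R) != 0 by rewrite pnatr_eq0.
rewrite exprS; move: k.+1%:R k`!%:R f0 k0 => a b b0 a0.
by field; rewrite b0.
Qed.

Lemma exp_bounded_cvg D C c t : exp_bounded D C c -> cvgn (pseries c t).
Proof.
move=> [D0 C0 cb]; apply: normed_cvg.
apply: (@series_le_cvg _ (fun k => `|c k * t ^+ k|) (fun k => D * exp_coeff (C * `|t|) k)).
- by move=> k.
- by move=> k; rewrite mulr_ge0 // exp_coeff_ge0 // mulr_ge0.
- move=> k; rewrite normrM normrX /exp_coeff /= exprMn.
  have := ler_wpM2r (exprn_ge0 k (normr_ge0 t)) (cb k).
  by move=> /le_trans; apply; rewrite le_eqVlt; apply/orP; left; apply/eqP; ring.
have -> : series (fun k => D * exp_coeff (C * `|t|) k) =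
    (fun k => D * series (exp_coeff (C * `|t|)) k).
  by apply/funext => k; rewrite /series /= mulr_sumr.
by apply: is_cvgMr; exact: is_cvg_series_exp_coeff.
Qed.

Lemma exp_bounded_is_derive D C c t : exp_bounded D C c ->
  is_derive t 1 (fun x => limn (pseries c x)) (limn (pseries (pseries_diffs c) t)).
Proof.
move=> cb; have db := exp_bounded_diffs cb; have ddb := exp_bounded_diffs db.
apply: (@pseries_snd_diffs _ c (`|t| + 1)).
- exact: exp_bounded_cvg cb.
- exact: exp_bounded_cvg db.
- exact: exp_bounded_cvg ddb.
by rewrite [ltRHS]ger0_norm ?ltrDl // addr_ge0.
Qed.

Definition expmx_coeff A i j : R^nat := fun k => (A ^+ k) i j / k`!%:R.

Let entry_sum A := \sum_i \sum_l `|A i l|.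

(** Every row sum of absolute values is at most [entry_sum A], so by induction its [k]-th power
    bounds the entries of [A ^+ k]. *)
Lemma expmx_coeff_bounded A i j : exp_bounded 1 (entry_sum A) (expmx_coeff A i j).
Proof.
have S0 : 0 <= entry_sum A by do 2!apply: sumr_ge0 => ? _.
split=> // k; rewrite mul1r normrM [X in _ * X]ger0_norm ?invr_ge0 //.
apply: ler_wpM2r; first by rewrite invr_ge0.
elim: k i j => [|k IH] i j.
  by rewrite !expr0 mxE; case: eqP => _; rewrite ?normr1 ?normr0.
rewrite !exprS mxE (le_trans (ler_norm_sum _ _ _)) //.
apply: (@le_trans _ _ (\sum_l `|A i l| * entry_sum A ^+ k)).
  by apply: ler_sum => l _; rewrite normrM ler_wpM2l.
rewrite -mulr_suml ler_wpM2r ?exprn_ge0 // /entry_sum [leRHS](bigD1 i) //=.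
by rewrite lerDl sumr_ge0 // => i' _; apply: sumr_ge0.
Qed.

Lemma cvg_mx_entries (u : nat -> 'M[R]_n.+1) (L : 'M[R]_n.+1) :
  (forall i j, u k i j @[k --> \oo] --> L i j) -> u @ \oo --> L.
Proof.
move=> uL; apply/cvgrPdist_le => /= e e0; near=> k.
rewrite /Num.Def.normr/= mx_normrE (bigmax_le _ (ltW e0)) //= => i _.
rewrite !mxE /=; move: i; near: k; apply: filter_forall => /= i.
exact: ((cvgrPdist_le _ _).1 (uL i.1 i.2)).
Unshelve. all: by end_near. Qed.

Lemma expmxE A t :
  expmx (t *: A) = \matrix_(i, j) limn (pseries (expmx_coeff A i j) t).
Proof.
apply: cvg_lim => //; apply: cvg_mx_entries => i j.
rewrite (_ : (fun k => _) = pseries (expmx_coeff A i j) t).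
  by rewrite mxE; exact: exp_bounded_cvg (expmx_coeff_bounded A i j).
apply/funext => k; rewrite /series /= summxE; apply: eq_bigr => l _.
have -> : (t *: A) ^+ l = t ^+ l *: A ^+ l by rewrite exprZn.
by rewrite !mxE /expmx_coeff mulrC [t ^+ l * _]mulrC mulrAC.
Qed.

Lemma is_derive_expmx A t :
  is_derive t 1 (fun s => expmx (s *: A)) (A *m expmx (t *: A)).
Proof.
apply/is_derive_mxP => i j.
rewrite (_ : (fun _ => _) = fun s => limn (pseries (expmx_coeff A i j) s)).
  have h := exp_bounded_is_derive t (expmx_coeff_bounded A i j).
  apply: (is_derive_eq h); apply: cvg_lim => //.
  (* The derived series has the coefficients [(A ^+ k.+1) i j / k!], from which one factor [A] is
     taken out on the left. *)
  rewrite (_ : pseries _ _ = fun k =>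
      \sum_l A i l * pseries (expmx_coeff A l j) t k); last first.
    apply/funext => k; rewrite /pseries /series /=.
    under [RHS]eq_bigr do rewrite mulr_sumr.
    rewrite exchange_big /=; apply: eq_bigr => m _.
    rewrite /pseries_diffs /expmx_coeff factS natrM invfM exprS mxE.
    rewrite [_%:R * _]mulrCA mulVKf ?pnatr_eq0 // !mulr_suml.
    by apply: eq_bigr => l _; rewrite !mulrA.
  rewrite expmxE mxE; apply: (cvg_big add_continuous) => l _; apply: cvgMl_tmp.
  rewrite mxE; exact: exp_bounded_cvg (expmx_coeff_bounded A l j).
by apply/funext => s; rewrite expmxE mxE.
Qed.

Lemma expmx0 A : expmx (0 *: A) = 1%:M.
Proof.
apply: cvg_lim => //; apply: cvg_near_cst; near=> k.
have k0 : (0 < k)%N by near: k; exists 1%N.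
rewrite /series /= big_ltn //.
rewrite big1_seq => [|l]; first by rewrite expr0 fact0 invr1 scale1r addr0.
rewrite mem_index_iota => /= /andP[l0 _].
by rewrite scale0r expr0n eqn0Ngt l0 scaler0.
Unshelve. all: by end_near. Qed.

(** The product E^T E has the derivative E^T (A^T + A) E, which is zero, so it keeps its value at
    [t = 0]. *)
Lemma expmx_orthogonal A t : Defs.skew A -> (expmx (t *: A))^T *m expmx (t *: A) = 1%:M.
Proof.
move=> skA; set E := fun s => expmx (s *: A).
have dE (s : R) : is_derive s 1 (fun s => (E s)^T *m E s) 0.
  have h := is_derive_expmx A s.
  apply: (is_derive_eq (is_derive_mulmx (is_derive_tr h) h)).
  by rewrite trmx_mul skA mulmxA mulmxN mulNmx addNr.
rewrite -[RHS]mul1mx -[X in _ = X *m _]trmx1 -(expmx0 A).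
apply/matrixP => i j.
apply: (@is_derive_0_is_cst _ (fun s => ((E s)^T *m E s) i j) t 0) => s.
by have /is_derive_mxP/(_ i j) := dE s; rewrite mxE.
Qed.

Lemma expmx_det_gt0 A : \forall t \near (0 : R), 0 < \det (expmx (t *: A)).
Proof.
have c : {for (0 : R), continuous (fun t => \det (expmx (t *: A)))}.
  have cE i j : {for (0 : R), continuous (fun t => expmx (t *: A) i j)}.
    apply: differentiable_continuous; apply/derivable1_diffP.
    by have /is_derive_mxP/(_ i j)[] := is_derive_expmx A 0.
  apply: (cvg_big add_continuous) => s _; apply: cvgMl_tmp.
  by apply: (cvg_big mul_continuous) => i _; exact: cE.
apply: (cvgr_gt _ c); rewrite expmx0 det1; exact: ltr01.
Qed.

End MatrixExponential.

(** * Orthonormalization along a curve *)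

Section MatrixDerivatives.
Context {R : realType} {V : normedModType R}.
Implicit Types (x v : V).

Lemma is_derive_scalemx m n (f : V -> R) (A : V -> 'M[R]_(m, n)) x v df dA :
  is_derive x v f df -> is_derive x v A dA ->
  is_derive x v (fun y => f y *: A y) (df *: A x + f x *: dA).
Proof.
move=> hf /is_derive_mxP hA; apply/is_derive_mxP => i j.
rewrite (_ : (fun _ => _) = fun y => f y * A y i j); last first.
  by apply/funext => y; rewrite mxE.
apply: (is_derive_eq (is_deriveM hf (hA i j))).
by rewrite !mxE addrC; congr (_ + _); exact: mulrC.
Qed.

Lemma is_derive_block_mx m1 m2 n1 n2 (A : V -> 'M[R]_(m1, n1))
    (B : V -> 'M[R]_(m1, n2)) (C : V -> 'M[R]_(m2, n1))
    (D : V -> 'M[R]_(m2, n2)) x v dA dB dC dD :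
  is_derive x v A dA -> is_derive x v B dB ->
  is_derive x v C dC -> is_derive x v D dD ->
  is_derive x v (fun y => block_mx (A y) (B y) (C y) (D y))
    (block_mx dA dB dC dD).
Proof.
move=> /is_derive_mxP hA /is_derive_mxP hB /is_derive_mxP hC /is_derive_mxP hD.
apply/is_derive_mxP => i j.
case: (split_ordP i) => k ->; case: (split_ordP j) => l ->.
- rewrite block_mxEul (_ : (fun _ => _) = fun y => A y k l) //.
  by apply/funext => y; rewrite block_mxEul.
- rewrite block_mxEur (_ : (fun _ => _) = fun y => B y k l) //.
  by apply/funext => y; rewrite block_mxEur.
- rewrite block_mxEdl (_ : (fun _ => _) = fun y => C y k l) //.
  by apply/funext => y; rewrite block_mxEdl.
- rewrite block_mxEdr (_ : (fun _ => _) = fun y => D y k l) //.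
  by apply/funext => y; rewrite block_mxEdr.
Qed.

Lemma is_derive_mxsub m n p q (f : 'I_p -> 'I_m) (g : 'I_q -> 'I_n)
    (A : V -> 'M[R]_(m, n)) x v dA :
  is_derive x v A dA ->
  is_derive x v (fun y => mxsub f g (A y)) (mxsub f g dA).
Proof.
move=> /is_derive_mxP hA; apply/is_derive_mxP => i j; rewrite mxE.
rewrite (_ : (fun _ => _) = fun y => A y (f i) (g j)) //.
by apply/funext => y; rewrite mxE.
Qed.

End MatrixDerivatives.

(** One step of Gram-Schmidt in block form. The first vector is divided by its length, and the block
    [- s^-1 *: (b^T *m N)] removes from the other vectors their components along it, which leaves
    the Schur complement as their Gram matrix. *)
Lemma orthonormalize_step (R : rcfType) n (S : 'M[R]_(1 + n)) (N : 'M[R]_n) :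
  let s := S 0 0 in let b := dlsubmx S in
  S^T = S -> 0 < s ->
  N^T *m (drsubmx S - s^-1 *: (b *m b^T)) *m N = 1%:M ->
  let P := block_mx (Num.sqrt s)^-1%:M (- s^-1 *: (b^T *m N)) 0 N in
  P^T *m S *m P = 1%:M.
Proof.
move=> s b Ssym s0 HN P.
have SE : S = block_mx s%:M b^T b (drsubmx S).
  rewrite -[LHS]submxK; congr block_mx.
    by rewrite [LHS]mx11_scalar; congr (_%:M); rewrite !mxE; congr (S _ _); apply/val_inj.
  by rewrite -[in LHS]Ssym /b -trmx_dlsub.
have sq : Num.sqrt s * Num.sqrt s = s by rewrite -expr2 sqr_sqrtr // ltW.
have sq0 : Num.sqrt s != 0 by rewrite gt_eqF // sqrtr_gt0.
have SP : S *m P = block_mx (Num.sqrt s)%:M 0 ((Num.sqrt s)^-1 *: b)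
    ((drsubmx S - s^-1 *: (b *m b^T)) *m N).
  rewrite [in LHS]SE /P mulmx_block !mulmx0 !addr0; congr block_mx.
  - by rewrite -scalar_mxM; congr _%:M; rewrite -[X in X / _]sq mulfK.
  - by rewrite mul_scalar_mx scalerA mulrN divff ?gt_eqF // scaleN1r addNr.
  - by rewrite mul_mx_scalar.
  - by rewrite mulmxBl -scalemxAr -scalemxAl scaleNr mulmxA addrC.
rewrite -mulmxA SP /P tr_block_mx trmx0 tr_scalar_mx mulmx_block.
rewrite !mul0mx !mulmx0 !addr0 add0r mulmxA HN linearZ /= trmx_mul trmxK.
rewrite -scalar_mxM mulVf // mul_mx_scalar -scalemxAr scalerA -scalerDl.
rewrite mulrN -[X in _ * X^-1]sq invfM mulrA divff // mul1r addNr scale0r.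
by rewrite -scalar_mx_block.
Qed.

(* [S] is the Gram matrix of a curve of frames that is orthonormal to first
   order; [N] makes the curve orthonormal without changing its velocity. *)
Lemma orthonormalize_curve (R : realType) n (S : R -> 'M[R]_n) :
  S 0 = 1%:M -> (forall t, (S t)^T = S t) -> is_derive (0 : R) 1 S 0 ->
  exists N : R -> 'M[R]_n, [/\ N 0 = 1%:M, is_derive (0 : R) 1 N 0 &
    \forall t \near (0 : R), (N t)^T *m S t *m N t = 1%:M].
Proof.
elim: n S => [|n IH] S S0 Ssym dS.
  exists (fun=> 1%:M); split=> //; first exact: is_derive_cst.
  by near=> t; apply/matrixP => -[].
pose s t : R := (S t : 'M[R]_(1 + n)) 0 0.
pose b t := dlsubmx (S t : 'M[R]_(1 + n)).
pose D t := drsubmx (S t : 'M[R]_(1 + n)).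
have ds : is_derive (0 : R) 1 s 0.
  by have /is_derive_mxP/(_ 0 0) := dS; rewrite mxE.
have db : is_derive (0 : R) 1 b 0.
  have -> : b = fun t => mxsub (@rshift 1 n) (@lshift 1 n) (S t).
    by apply/funext => t; rewrite -dlsubmxEsub.
  apply: (is_derive_eq (is_derive_mxsub (@rshift 1 n) (@lshift 1 n) dS)).
  by apply/matrixP => i j; rewrite !mxE.
have dD : is_derive (0 : R) 1 D 0.
  have -> : D = fun t => mxsub (@rshift 1 n) (@rshift 1 n) (S t).
    by apply/funext => t; rewrite -drsubmxEsub.
  apply: (is_derive_eq (is_derive_mxsub (@rshift 1 n) (@rshift 1 n) dS)).
  by apply/matrixP => i j; rewrite !mxE.
have s1 : s 0 = 1 by rewrite /s S0 mxE eqxx.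
have b1 : b 0 = 0.
  by rewrite /b S0 (@scalar_mx_block _ 1 n) block_mxKdl.
have D1 : D 0 = 1%:M.
  by rewrite /D S0 (@scalar_mx_block _ 1 n) block_mxKdr.
(* As [s] has derivative 0 at 0, so has every differentiable function of it; this is applied to the
   inverse and to the inverse of the square root. *)
have dr (f : R -> R) : differentiable f (1 : R) -> is_derive (0 : R) 1 (f \o s) 0.
  move=> df; have := @is_derive_chain _ _ _ _ f s 0 1 0.
  by rewrite s1 derive0; apply.
have di : is_derive (0 : R) 1 (fun t => (s t)^-1) 0.
  by apply: (dr (fun x => x^-1)); apply: differentiableV; rewrite ?oner_eq0.
have dsq : is_derive (0 : R) 1 (fun t => (Num.sqrt (s t))^-1) 0.
  apply: (dr (fun x => (Num.sqrt x)^-1)); apply: differentiableV.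
    apply/derivable1_diffP.
    by have [] := @is_derive1_sqrt _ (1 : R) ltr01.
  by rewrite sqrtr1 oner_eq0.
(* The Schur complement is again the identity to first order, since the block [b] and its derivative
   vanish at 0. *)
pose S1 t := D t - (s t)^-1 *: (b t *m (b t)^T).
have [||| N [N0 dN HN]] := IH S1.
- by rewrite /S1 b1 mul0mx scaler0 subr0.
- move=> t; rewrite /S1 linearB linearZ /= trmx_mul trmxK; congr (_ - _).
  by rewrite /D trmx_drsub Ssym.
- have h := is_derive_scalemx di (is_derive_mulmx db (is_derive_tr db)).
  apply: (is_derive_eq (is_deriveB dD h)).
  by rewrite scale0r trmx0 mul0mx mulmx0 addr0 scaler0 addr0 subr0.
exists (fun t => block_mx (Num.sqrt (s t))^-1%:M
                   (- (s t)^-1 *: ((b t)^T *m N t)) 0 (N t) : 'M[R]_(1 + n)).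
split.
- rewrite s1 b1 N0 sqrtr1 invr1 trmx0 mul0mx scaler0.
  by rewrite -(@scalar_mx_block _ 1 n).
- have -> : 0 = block_mx 0 0 0 0 :> 'M[R]_(1 + n) by rewrite block_mx_const.
  apply: (@is_derive_block_mx R R 1 n 1 n (fun t => (Num.sqrt (s t))^-1%:M)
    (fun t => - (s t)^-1 *: ((b t)^T *m N t)) (fun=> 0) N 0 1 0 0 0 0) => //.
  + apply/is_derive_mxP => i j; rewrite mxE.
    rewrite (_ : (fun _ => _) = (fun t => (Num.sqrt (s t))^-1)) //.
    by apply/funext => t; rewrite !ord1 mxE eqxx.
  + have h := is_derive_scalemx (is_deriveN di) (is_derive_mulmx (is_derive_tr db) dN).
    apply: (is_derive_eq h).
    by rewrite oppr0 scale0r trmx0 mul0mx mulmx0 addr0 scaler0 addr0.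
- have cs : {for (0 : R), continuous s}.
    by apply: differentiable_continuous; apply/derivable1_diffP; case: ds.
  have sp : \forall t \near (0 : R), 0 < s t.
    by apply: (cvgr_gt _ cs); rewrite s1.
  near=> t; apply: orthonormalize_step => //; first by near: t.
  by near: t.
Unshelve. all: by end_near. Qed.

(** * Changes of charts *)

Lemma mulmx_col_ext (R : pzSemiRingType) m n (A B : 'M[R]_(m, n)) :
  (forall v : 'cV_n, A *m v = B *m v) -> A = B.
Proof.
move=> AB; apply/matrixP => i j; have := AB (delta_mx j 0).
by rewrite -!colE => /colP/(_ i); rewrite !mxE.
Qed.

Section ChartChanges.
Context {R : realType} {M : topologicalType} {n : nat}.
Variable X : @oriented_manifold R M n.
Implicit Types (k c e : @chart R M n) (p : M) (x y u v : 'cV[R]_n).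

Definition overlap k c : set 'cV[R]_n := k @` (chart_dom k `&` chart_dom c).

Definition transition k c : 'cV[R]_n -> 'cV[R]_n := c \o chart_inv k.

Lemma chartK k p : chart_dom k p -> chart_inv k (k p) = p.
Proof. by move=> kp; apply: chart_mapK; rewrite inE. Qed.

Lemma overlap_in k c p : chart_dom k p -> chart_dom c p -> overlap k c (k p).
Proof. by move=> kp cp; exists p. Qed.

Lemma overlapP k c y : overlap k c y ->
  [/\ chart_dom k (chart_inv k y), chart_dom c (chart_inv k y) &
      k (chart_inv k y) = y].
Proof. by move=> [p [kp cp] <-]; rewrite chartK. Qed.

Lemma overlap_open k c : open (overlap k c).
Proof.
rewrite openE => y ov; have [ky cy yE] := overlapP ov.
have iy : chart_img k y by exists (chart_inv k y).
have ni : \forall z \near y, chart_img k z.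
  by apply: open_nbhs_nbhs; split=> //; exact: chart_img_open.
have nc : \forall z \near y, chart_dom c (chart_inv k z).
  have ci : {for y, continuous (chart_inv k)}.
    by apply: chart_inv_continuous; rewrite inE.
  by apply: ci; apply: open_nbhs_nbhs; split=> //; exact: chart_dom_open.
rewrite /interior; apply: filterS2 ni nc => _ [p kp <-].
by rewrite chartK // => cp; exists p.
Qed.

Lemma chart_img_openP k : open (chart_img k).
Proof. exact: chart_img_open. Qed.

Lemma chart_imgP k y : chart_img k y ->
  chart_dom k (chart_inv k y) /\ k (chart_inv k y) = y.
Proof. by move=> [p kp <-]; rewrite chartK. Qed.

Lemma overlap_chart_img k c y : overlap k c y -> chart_img k y.
Proof. by move=> [p [kp _] <-]; exists p. Qed.

Lemma transition_smooth k c : atlas X k -> atlas X c ->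
  smooth_on (overlap k c) (transition k c).
Proof. by move=> Xk Xc; exact: (atlas_smooth Xk Xc). Qed.

Lemma sum_basisv v : v = \sum_l v l 0 *: basisv l.
Proof.
by rewrite [LHS]matrix_sum_delta; apply: eq_bigr => l _; rewrite big_ord1.
Qed.

Lemma derive_basis (W : normedModType R) (f : 'cV[R]_n -> W) x v :
  differentiable f x -> 'D_v f x = \sum_l v l 0 *: 'D_(basisv l) f x.
Proof.
move=> df; rewrite deriveE // {1}(sum_basisv v) linear_sum.
by apply: eq_bigr => l _; rewrite linearZ /= deriveE.
Qed.

Lemma jac_mul k c p v : atlas X k -> atlas X c ->
  chart_dom k p -> chart_dom c p ->
  jac k c p *m v = 'D_v (transition k c) (k p).
Proof.
move=> Xk Xc kp cp.
have df : differentiable (transition k c) (k p).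
  exact: smooth_on_differentiable (transition_smooth Xk Xc) (overlap_in kp cp).
rewrite (derive_basis v df); apply/colP => i; rewrite mxE summxE.
by apply: eq_bigr => j _; rewrite !mxE mulrC.
Qed.

Lemma jac_id k p : atlas X k -> chart_dom k p -> jac k k p = 1%:M.
Proof.
move=> Xk kp; apply/matrixP => i j; rewrite !mxE.
have -> : 'D_(basisv j) (transition k k) (k p) = 'D_(basisv j) id (k p).
  apply: near_eq_derive.
  have : nbhs (k p) (overlap k k).
    by apply: open_nbhs_nbhs; split; [exact: overlap_open|exact: overlap_in].
  by apply: filterS => y /overlapP[].
by rewrite derive_id !mxE eqxx andbT.
Qed.

Lemma jac_chain k c e p : atlas X k -> atlas X c -> atlas X e ->
  chart_dom k p -> chart_dom c p -> chart_dom e p ->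
  jac k e p = jac c e p *m jac k c p.
Proof.
move=> Xk Xc Xe kp cp ep.
suff E v : jac k e p *m v = jac c e p *m jac k c p *m v.
  by apply: mulmx_col_ext => v; rewrite E.
rewrite -mulmxA (jac_mul v Xk Xe kp ep) (jac_mul v Xk Xc kp cp).
rewrite (jac_mul _ Xc Xe cp ep).
have dk : differentiable (transition k c) (k p).
  exact: smooth_on_differentiable (transition_smooth Xk Xc) (overlap_in kp cp).
have tk : transition k c (k p) = c p by rewrite /transition /= chartK.
have dc : differentiable (transition c e) (transition k c (k p)).
  rewrite tk.
  exact: smooth_on_differentiable (transition_smooth Xc Xe) (overlap_in cp ep).
have [_ h] := is_derive_chain dc (derivableP (diff_derivable (v := v) dk)).
rewrite tk in h; rewrite -h; apply: near_eq_derive.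
have : nbhs (k p) (overlap k c).
  by apply: open_nbhs_nbhs; split; [exact: overlap_open|exact: overlap_in].
apply: filterS => y /overlapP[ky cy _].
by rewrite /transition /= chartK.
Qed.

Lemma jac_unit k c p : atlas X k -> atlas X c ->
  chart_dom k p -> chart_dom c p -> jac k c p \in unitmx.
Proof.
move=> Xk Xc kp cp.
by rewrite unitmxE unitfE gt_eqF //; exact: (atlas_oriented Xk Xc).
Qed.

Lemma jac_inv k c p : atlas X k -> atlas X c ->
  chart_dom k p -> chart_dom c p -> jac c k p *m jac k c p = 1%:M.
Proof. by move=> Xk Xc kp cp; rewrite -jac_chain // (jac_id Xk). Qed.

(** The Jacobian as a function of the coordinates in [k], so that it can be differentiated: its
    derivative is the inhomogeneous term in the transformation law of the Christoffel symbols. *)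
Definition jac_coord k c y : 'M[R]_n := jac k c (chart_inv k y).

Lemma jac_coordE k c y i j : overlap k c y ->
  jac_coord k c y i j = ('D_(basisv j) (transition k c) y) i 0.
Proof. by move=> /overlapP[_ _ yE]; rewrite mxE yE. Qed.

Lemma jac_coord_smooth k c : atlas X k -> atlas X c ->
  smooth_mx_on (overlap k c) (jac_coord k c).
Proof.
move=> Xk Xc i j; have ov := @overlap_open k c.
have h := smooth_on_mx ov (smooth_on_derive (basisv j) (transition_smooth Xk Xc)).
by apply: smooth_on_ext (h i 0) => // y oy; rewrite jac_coordE.
Qed.

Lemma is_derive_smooth_mx (V : normedModType R) m m' (U : set V)
    (A : V -> 'M[R]_(m, m')) (x v : V) :
  smooth_mx_on U A -> U x -> is_derive x v A ('D_v A x).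
Proof.
move=> sA Ux; apply: derivableP; apply/derivable_mxP => i j.
by apply: diff_derivable; exact: smooth_on_differentiable (sA i j) Ux.
Qed.

(** Both sides are the second derivative of the change of coordinates along [u] and [v]. *)
Lemma derive_jac_coord_sym k c x u v : atlas X k -> atlas X c ->
  overlap k c x ->
  'D_u (jac_coord k c) x *m v = 'D_v (jac_coord k c) x *m u.
Proof.
move=> Xk Xc ox; have ov := @overlap_open k c.
have sT := smooth_on_mx ov (transition_smooth Xk Xc).
have sJ := jac_coord_smooth Xk Xc.
have nx : nbhs x (overlap k c) by apply: open_nbhs_nbhs.
have JE w y : overlap k c y ->
    jac_coord k c y *m w = \col_i 'D_w (fun z => transition k c z i 0) y.
  move=> oy; have [ky cy yE] := overlapP oy.
  rewrite /jac_coord jac_mul // yE derive_mx; last first.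
    by apply: diff_derivable; exact: smooth_on_differentiable (transition_smooth Xk Xc) oy.
  by apply/colP => i; rewrite !mxE.
have DE a b i : ('D_a (jac_coord k c) x *m b) i 0 =
    'D_a ('D_b (fun z => transition k c z i 0)) x.
  have h := is_derive_mulmx (is_derive_smooth_mx a sJ ox) (is_derive_cst b x a).
  have /is_derive_mxP/(_ i 0) [_] := h.
  rewrite mulmx0 addr0 => <-; apply: near_eq_derive.
  by apply: filterS nx => y oy; rewrite JE // mxE.
apply/colP => i; rewrite !DE.
exact: (derive_swap _ _ ov ox (sT i 0)).
Qed.

Lemma form_in_chart_change (S : M -> 'M[R]_n) k c y : atlas X k -> atlas X c ->
  overlap k c y ->
  form_in_chart X S k y = (jac_coord k c y)^T *m
    form_in_chart X S c (transition k c y) *m jac_coord k c y.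
Proof.
move=> Xk Xc /overlapP[ky cy yE]; rewrite /form_in_chart /transition /=.
rewrite (chartK cy) /jac_coord.
have Xp := chart_at_atlas X (chart_inv k y).
have dp := chart_at_dom X (chart_inv k y).
by rewrite (jac_chain Xk Xc Xp) // trmx_mul !mulmxA.
Qed.

End ChartChanges.

(** * Transformation of the Christoffel symbols *)

Section Bilin.
Context {R : realType} {n : nat}.
Implicit Types (A B : 'M[R]_n) (u v z : 'cV[R]_n).

Lemma bilinBl A u v z : bilin A (u - v) z = bilin A u z - bilin A v z.
Proof. by rewrite /bilin linearB /= !mulmxBl !mxE. Qed.

Lemma bilinBr A u v z : bilin A z (u - v) = bilin A z u - bilin A z v.
Proof. by rewrite /bilin !mulmxBr !mxE. Qed.

Lemma bilinDm A B u v : bilin (A + B) u v = bilin A u v + bilin B u v.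
Proof. by rewrite /bilin !(mulmxDr, mulmxDl) !mxE. Qed.

Lemma bilin_congr A (P Q : 'M[R]_n) u v :
  bilin (P^T *m A *m Q) u v = bilin A (P *m u) (Q *m v).
Proof. by rewrite /bilin trmx_mul !mulmxA. Qed.

End Bilin.

Section ChristoffelChange.
Context {R : realType} {M : topologicalType} {n : nat}.
Context {X : @oriented_manifold R M n}.
Variable g : riemannian_metric X.
Implicit Types (k c : @chart R M n) (p : M) (x y u v z : 'cV[R]_n).

Local Notation G c := (form_in_chart X g c).

Lemma form_in_chart_sym c y : (G c y)^T = G c y.
Proof. by rewrite /form_in_chart !trmx_mul trmxK Defs.metric_sym mulmxA. Qed.

Lemma form_in_chart_unit c y : atlas X c -> chart_img c y -> G c y \in unitmx.
Proof.
move=> Xc /chart_imgP[cp _]; rewrite /form_in_chart.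
have ju := jac_unit Xc (chart_at_atlas X (chart_inv c y)) cp (chart_at_dom X _).
by rewrite !unitmx_mul unitmx_tr ju metric_unit.
Qed.

Lemma metric_chart_smooth c : atlas X c -> smooth_mx_on (chart_img c) (G c).
Proof.
move=> Xc; apply: smooth_on_mx; first exact: chart_img_openP.
exact: metric_smooth.
Qed.

Lemma metric_chart_differentiable c y : atlas X c -> chart_img c y ->
  differentiable (G c) y.
Proof.
by move=> Xc cy; exact: smooth_on_differentiable (metric_smooth g Xc) cy.
Qed.

Lemma christoffel_sum c y u v : atlas X c -> chart_img c y ->
  christoffel g c y u v = \sum_l v l 0 *: christoffel g c y u (basisv l).
Proof.
move=> Xc cy; have dG := metric_chart_differentiable Xc cy.
rewrite /christoffel.
under [RHS]eq_bigr do rewrite scalemxAr.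
rewrite -mulmx_sumr; congr (_ *m _); apply/colP => i.
rewrite mxE summxE.
under [RHS]eq_bigr do rewrite !mxE mulrCA.
rewrite -mulr_sumr; congr (_ * _).
under [RHS]eq_bigr do rewrite mulrBr mulrDr.
rewrite sumrB big_split /=; congr (_ + _ - _).
- rewrite /bilin {1}(sum_basisv v) linear_sum !mulmx_suml summxE.
  by apply: eq_bigr => l _; rewrite linearZ /= -!scalemxAl mxE.
- rewrite (derive_basis v dG) /bilin mulmx_sumr mulmx_suml summxE.
  by apply: eq_bigr => l _; rewrite -scalemxAr -scalemxAl mxE.
- rewrite /bilin {1}(sum_basisv v) mulmx_sumr summxE.
  by apply: eq_bigr => l _; rewrite -!scalemxAr mxE.
Qed.

Definition christoffel_mx c y u : 'M[R]_n :=
  \matrix_(i, j) christoffel g c y u (basisv j) i 0.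

Lemma christoffel_mxE c y u v : atlas X c -> chart_img c y ->
  christoffel_mx c y u *m v = christoffel g c y u v.
Proof.
move=> Xc cy; rewrite (christoffel_sum u v Xc cy); apply/colP => i.
rewrite mxE summxE; apply: eq_bigr => j _.
by rewrite !mxE mulrC.
Qed.

(** Linearity in [u] is linearity in the other argument, transported by the symmetry of the
    Christoffel symbols. *)
Lemma christoffel_mx_sum c y u : atlas X c -> chart_img c y ->
  christoffel_mx c y u = \sum_l u l 0 *: christoffel_mx c y (basisv l).
Proof.
move=> Xc cy; apply/matrixP => i j; rewrite mxE summxE.
rewrite (christoffel_torsion_free g Xc cy) (christoffel_sum _ u Xc cy) summxE.
apply: eq_bigr => l _; rewrite (christoffel_torsion_free g Xc cy).
by rewrite /christoffel_mx [LHS]mxE [RHS]mxE; congr (_ * _); rewrite [RHS]mxE.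
Qed.

Lemma metric_derive_change k c x u : atlas X k -> atlas X c -> overlap k c x ->
  let J := jac_coord k c x in let H := 'D_u (jac_coord k c) x in
  let y := transition k c x in
  'D_u (G k) x = H^T *m G c y *m J + J^T *m 'D_(J *m u) (G c) y *m J +
     J^T *m G c y *m H.
Proof.
move=> Xk Xc ox J H y; have ov := @overlap_open _ _ _ k c.
have [kp cp yE] := overlapP ox.
have cy : chart_img c y by exists (chart_inv k x).
have nx : nbhs x (overlap k c) by apply: open_nbhs_nbhs.
have dT : is_derive x u (transition k c) (J *m u).
  apply: (@DeriveDef _ _ _ _ _ _ (J *m u)).
    apply: diff_derivable.
    exact: smooth_on_differentiable (transition_smooth Xk Xc) ox.
  by rewrite /J /jac_coord (jac_mul u Xk Xc kp cp) yE.
have dJ := is_derive_smooth_mx u (jac_coord_smooth Xk Xc) ox.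
have dG := is_derive_chain (metric_chart_differentiable Xc cy) dT.
have [_ h] := is_derive_mulmx (is_derive_mulmx (is_derive_tr dJ) dG) dJ.
have e : 'D_u (G k) x = 'D_u (fun z => (jac_coord k c z)^T *m
    (form_in_chart X g c \o transition k c) z *m jac_coord k c z) x.
  apply: near_eq_derive; apply: filterS nx => z oz.
  exact: form_in_chart_change.
by rewrite mulmxDl in h; exact: etrans e h.
Qed.

Lemma bilin_metric_change k c x u v : atlas X k -> atlas X c ->
  overlap k c x ->
  bilin (G k x) u v = bilin (G c (transition k c x))
    (jac_coord k c x *m u) (jac_coord k c x *m v).
Proof.
by move=> Xk Xc ox; rewrite (form_in_chart_change g Xk Xc ox) bilin_congr.
Qed.

Lemma bilin_metric_derive_change k c x u v z : atlas X k -> atlas X c ->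
  overlap k c x ->
  let J := jac_coord k c x in let H := 'D_u (jac_coord k c) x in
  let y := transition k c x in
  bilin ('D_u (G k) x) v z = bilin (G c y) (H *m v) (J *m z) +
    bilin ('D_(J *m u) (G c) y) (J *m v) (J *m z) +
    bilin (G c y) (J *m v) (H *m z).
Proof.
move=> Xk Xc ox J H y.
apply: etrans (congr1 (fun A => bilin A v z) (metric_derive_change u Xk Xc ox)) _.
by rewrite bilinDm bilinDm; congr (_ + _ + _); exact: bilin_congr.
Qed.

(* The Koszul argument: the difference D of the two sides satisfies
   <D(u,v), z> = - <v, D(u,z)> and D(u,v) = D(v,u), hence vanishes. *)
Lemma christoffel_change k c x u v : atlas X k -> atlas X c -> overlap k c x ->
  let J := jac_coord k c x in
  christoffel g c (transition k c x) (J *m u) (J *m v) =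
  J *m christoffel g k x u v - 'D_u (jac_coord k c) x *m v.
Proof.
move=> Xk Xc ox J; set y := transition k c x.
have [kp cp yE] := overlapP ox.
have cy : chart_img c y by exists (chart_inv k x).
have kx : chart_img k x by exact: overlap_chart_img ox.
pose H a := 'D_a (jac_coord k c) x.
pose D a b := J *m christoffel g k x a b - H a *m b -
  christoffel g c y (J *m a) (J *m b).
pose B a b z := bilin (G c y) (D a b) (J *m z).
have Dsym a b : D a b = D b a.
  have h1 := christoffel_torsion_free g Xk kx a b.
  have h2 := christoffel_torsion_free g Xc cy (J *m a) (J *m b).
  have h3 := derive_jac_coord_sym a b Xk Xc ox.
  exact: (congr2 (fun r s => r - s) (congr2 (fun r s => J *m r - s) h1 h3) h2).
have Bsym a b z : B a b z = B b a z by rewrite /B Dsym.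
have sG a b : bilin (G c y) a b = bilin (G c y) b a.
  exact/bilin_sym/form_in_chart_sym.
have alg (d1 d2 p1 p2 q1 q2 h1 h2 : R) : d1 = p1 + p2 -> d2 = q1 + q2 ->
    d1 = h1 + d2 + h2 -> p1 - h1 - q1 = - (p2 - h2 - q2).
  by move=> e1 e2 e3; lra.
(* The derivative of the metric along [a] is computed in two ways: by metric compatibility in [k],
   and by the change of chart followed by metric compatibility in [c]. *)
have Bskew a b z : B a b z = - B a z b.
  have m1 : bilin ('D_a (G k) x) b z =
      bilin (G c y) (J *m christoffel g k x a b) (J *m z) +
      bilin (G c y) (J *m b) (J *m christoffel g k x a z).
    apply: etrans (christoffel_metric g Xk kx a b z) _.
    by congr (_ + _); exact: bilin_metric_change.
  have m2 := christoffel_metric g Xc cy (J *m a) (J *m b) (J *m z).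
  have m3 := bilin_metric_derive_change a b z Xk Xc ox.
  rewrite /B /D [X in _ = - X]sG !bilinBl !bilinBr.
  exact: alg m1 m2 m3.
have neg_self (q : R) : q = - q -> q = 0 by move=> ?; lra.
(* Three uses of skewness in the last two arguments, alternating with three of symmetry in the first
   two, lead back to the same triple with the opposite sign. *)
have B0 a b z : B a b z = 0.
  apply: neg_self.
  by rewrite {1}Bskew Bsym Bskew opprK Bsym Bskew Bsym.
have D0 : D u v = 0.
  have ju : G c y *m J \in unitmx.
    by rewrite unitmx_mul form_in_chart_unit //= /J /jac_coord (jac_unit Xk Xc).
  have e : (D u v)^T *m (G c y *m J) = 0.
    apply: mulmx_col_ext => z; apply/matrixP => i j; rewrite !ord1.
    rewrite mul0mx [RHS]mxE; apply: etrans (B0 u v z).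
    by rewrite /B /bilin !mulmxA.
  have e2 : (D u v)^T = 0 by rewrite -[LHS](mulmxK ju) e mul0mx.
  by rewrite -[LHS]trmxK e2 trmx0.
by apply/esym/eqP; rewrite -subr_eq0; apply/eqP.
Qed.

End ChristoffelChange.

(** * Coordinates on the frame bundle *)

Section SkewBasis.
Context {R : realType} {n : nat}.
Implicit Types (A : 'M[R]_n) (x y : 'cV[R]_n).

Lemma bilin_tr A x y : bilin A^T x y = bilin A y x.
Proof.
rewrite /bilin; have -> : x^T *m A^T *m y = (y^T *m A *m x)^T.
  by rewrite !trmx_mul trmxK mulmxA.
by rewrite mxE.
Qed.

Lemma bilinNm A x y : bilin (- A) x y = - bilin A x y.
Proof. by rewrite /bilin mulmxN mulNmx mxE. Qed.

Lemma skew_bilin A x y : Defs.skew A -> bilin A x y = - bilin A y x.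
Proof. by move=> skA; rewrite -bilin_tr skA bilinNm. Qed.

Lemma dot_bilin A x y : dot (A *m x) y = bilin A^T x y.
Proof. by rewrite /dot /bilin trmx_mul. Qed.

Lemma so_dot_wedge A x y : Defs.skew A -> so_dot A (wedge x y) = dot (A *m x) y.
Proof.
move=> skA; have trE u v : \tr (A *m (v *m u^T)) = bilin A u v.
  by rewrite mulmxA mxtrace_mulC mulmxA /mxtrace big_ord1.
rewrite /so_dot /wedge mulmxBr linearB /= !trE dot_bilin skA bilinNm.
by rewrite (skew_bilin y x skA); move: (bilin _ _ _) => q; lra.
Qed.

Lemma wedge_skew x y : Defs.skew (wedge x y).
Proof. by rewrite /Defs.skew /wedge linearB /= !trmx_mul !trmxK opprB. Qed.

Lemma wedge_basisv i j : wedge (basisv i) (basisv j) =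
  delta_mx j i - delta_mx i j :> 'M[R]_n.
Proof. by rewrite /wedge /basisv !trmx_delta !mul_delta_mx. Qed.

(** [vert_fun] is defined as a combination of the vertical fields of the basis; this expansion
    gathers them into a single vertical direction. *)
Lemma skew_basis A : Defs.skew A ->
  A = \sum_(i < n) \sum_(j < n | (i < j)%N)
        so_dot A (wedge (basisv i) (basisv j)) *: wedge (basisv i) (basisv j).
Proof.
move=> skA; have sA a b : A a b = - A b a.
  by have /matrixP/(_ b a) := skA; rewrite !mxE.
have cE i j : so_dot A (wedge (basisv i) (basisv j)) = A j i.
  rewrite so_dot_wedge // /dot trmx_mul /basisv trmx_delta -mulmxA.
  by rewrite -rowE -colE !mxE.
apply/matrixP => a b; rewrite summxE.
under eq_bigr do (rewrite summxE; under eq_bigr do rewrite cE wedge_basisv !mxE).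
(* The two halves pick out the entries below and above the diagonal. The diagonal remains, where a
   skew matrix vanishes. *)
pose f i j := A j i * ((a == j) && (b == i))%:R - A j i * ((a == i) && (b == j))%:R.
transitivity (\sum_(i < n) \sum_(j < n | (i < j)%N) f i j); last first.
  by apply: eq_bigr => i _; apply: eq_bigr => j _; rewrite /f -mulrBr.
under eq_bigr do rewrite sumrB.
rewrite sumrB.
have -> : \sum_(i < n) \sum_(j < n | (i < j)%N)
    A j i * ((a == j) && (b == i))%:R = if (b < a)%N then A a b else 0.
  rewrite (bigD1 b) //= [X in _ + X]big1 ?addr0; last first.
    by move=> i ib; apply: big1 => j _; rewrite eq_sym (eq_sym b) (negbTE ib) andbF mulr0.
  case: ifP => ba.
    rewrite (bigD1 a) //= !eqxx mulr1 big1 ?addr0 // => j /andP[_ ja].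
    by rewrite eq_sym (negbTE ja) mulr0.
  apply: big1 => j bj; case: eqP => [aj|_]; last by rewrite mulr0.
  by rewrite aj bj in ba.
have -> : \sum_(i < n) \sum_(j < n | (i < j)%N)
    A j i * ((a == i) && (b == j))%:R = if (a < b)%N then A b a else 0.
  rewrite (bigD1 a) //= [X in _ + X]big1 ?addr0; last first.
    by move=> i ia; apply: big1 => j _; rewrite (eq_sym a) (negbTE ia) mulr0.
  case: ifP => ab.
    rewrite (bigD1 b) //= !eqxx mulr1 big1 ?addr0 // => j /andP[_ jb].
    by rewrite (eq_sym b) (negbTE jb) andbF mulr0.
  apply: big1 => j aj; case: (b =P j) => [bj|_]; last by rewrite andbF mulr0.
  by rewrite bj aj in ab.
case: ltngtP => [_|_|/val_inj ab]; rewrite ?subr0 ?sub0r //.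
by rewrite ab; have := sA a a; move: (A a a) => q; lra.
Qed.

End SkewBasis.

(** Forms are pulled back by [J] while vectors are moved by its inverse [K], so Gram matrices do not
    depend on the coordinates. *)
Lemma congruence_cancel (R : comPzRingType) m n (J K S : 'M[R]_m)
    (A : 'M[R]_(m, n)) : J *m K = 1%:M ->
  (K *m A)^T *m (J^T *m S *m J) *m (K *m A) = A^T *m S *m A.
Proof.
move=> JK; have KJ : K^T *m J^T = 1%:M by rewrite -trmx_mul JK trmx1.
rewrite trmx_mul !mulmxA -[_ *m K^T *m J^T]mulmxA KJ mulmx1.
by rewrite -[_ *m J *m K]mulmxA JK mulmx1.
Qed.

Section FrameCoordinates.
Context {R : realType} {M : topologicalType} {n : nat}.
Context {X : @oriented_manifold R M n.+1}.
Variable g : riemannian_metric X.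
Implicit Types (k c : @chart R M n.+1) (w : @frame R M n) (p : M).
Implicit Types (x y u : 'cV[R]_n.+1).

Local Notation G c := (form_in_chart X g c).
Local Notation E := ('cV[R]_n.+1 * 'M[R]_n.+1)%type.

Definition coord c w : E := (c w.1, frame_coord (X := X) c w).

Definition hvec c (q : E) x : E :=
  (q.2 *m x, - christoffel_mx g c q.1 (q.2 *m x) *m q.2).

Definition vvec (q : E) (xi : 'M[R]_n.+1) : E := (0, q.2 *m xi).

Lemma frame_coord_change k c w : atlas X k -> atlas X c ->
  chart_dom k w.1 -> chart_dom c w.1 ->
  frame_coord (X := X) c w = jac k c w.1 *m frame_coord (X := X) k w.
Proof.
move=> Xk Xc kw cw; rewrite /frame_coord mulmxA.
by rewrite -(jac_chain (chart_at_atlas X w.1) Xk Xc (chart_at_dom X w.1) kw cw).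
Qed.

Lemma frame_coord_at w : frame_coord (X := X) (chart_at X w.1) w = w.2.
Proof.
rewrite /frame_coord (jac_id (chart_at_atlas X _)) ?mul1mx //.
exact: chart_at_dom.
Qed.

Lemma FM_coord c w : atlas X c -> chart_dom c w.1 -> FM g w ->
  (coord c w).2^T *m G c (c w.1) *m (coord c w).2 = 1%:M /\
  0 < \det (coord c w).2.
Proof.
move=> Xc cw [ortho dw]; split; last first.
  rewrite det_mulmx mulr_gt0 //; apply: (atlas_oriented (chart_at_atlas X _)) => //.
  exact: chart_at_dom.
rewrite /= /form_in_chart (chartK cw) -[RHS]ortho; apply: congruence_cancel.
apply: mulmx1C; exact: jac_inv Xc (chart_at_atlas X w.1) cw (chart_at_dom X w.1).
Qed.

End FrameCoordinates.

(** * Horizontal curves in an arbitrary chart *)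

Section HorizontalCurves.
Context {R : realType} {M : topologicalType} {n : nat}.
Context {X : @oriented_manifold R M n.+1}.
Variable g : riemannian_metric X.
Implicit Types (k c : @chart R M n.+1) (w : @frame R M n) (p : M).
Implicit Types (x y u : 'cV[R]_n.+1).

Lemma is_derive_continuous (W : normedModType R) (f : R -> W) (t : R) df :
  is_derive t 1 f df -> {for t, continuous f}.
Proof.
by move=> [h _]; apply: differentiable_continuous; apply/derivable1_diffP.
Qed.

Lemma is_derive_chain_mx (V W : normedModType R) (U : set W) m m'
    (A : W -> 'M[R]_(m, m')) (c : V -> W) (t v : V) dc :
  smooth_mx_on U A -> U (c t) -> is_derive t v c dc ->
  is_derive t v (A \o c) ('D_dc A (c t)).
Proof.
move=> sA Uc dcv; apply/is_derive_mxP => i j.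
have [_ <-] : is_derive (c t) dc (fun z => A z i j) ('D_dc A (c t) i j).
  by have /is_derive_mxP := is_derive_smooth_mx dc sA Uc.
by apply: is_derive_chain => //; exact: smooth_on_differentiable (sA i j) Uc.
Qed.

Lemma continuous_det m (A : R -> 'M[R]_m) (t : R) dA : is_derive t 1 A dA ->
  {for t, continuous (fun s => \det (A s))}.
Proof.
move=> /is_derive_mxP hA; apply: (cvg_big add_continuous) => s _.
apply: cvgMl_tmp; apply: (cvg_big mul_continuous) => i _.
exact: (is_derive_continuous (hA i _)).
Qed.

Lemma christoffel_mx_change k c x u : atlas X k -> atlas X c ->
  overlap k c x ->
  let J := jac_coord k c x in
  christoffel_mx g c (transition k c x) (J *m u) *m J =
  J *m christoffel_mx g k x u - 'D_u (jac_coord k c) x.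
Proof.
move=> Xk Xc ox J; have [kp cp yE] := overlapP ox.
have cy : chart_img c (transition k c x) by exists (chart_inv k x).
have kx : chart_img k x by exact: overlap_chart_img ox.
apply: mulmx_col_ext => v.
rewrite -mulmxA (christoffel_mxE g _ _ Xc cy) mulmxBl -mulmxA.
rewrite (christoffel_mxE g _ _ Xk kx).
exact: christoffel_change.
Qed.

(** The frame in the chart [c] is the Jacobian times the frame in the preferred chart, and
    differentiating the Jacobian adds a term to its velocity. That term is the inhomogeneous one in
    [christoffel_mx_change], so the velocity has the same form in every chart. *)
Lemma horizontal_curve_coord w x c (gam : R -> @frame R M n) :
  atlas X c -> chart_dom c w.1 -> horizontal_curve g w (w.2 *m x) gam ->
  is_derive (0 : R) 1 (fun t => coord (X := X) c (gam t))
    (hvec g c (coord (X := X) c w) x) /\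
  \forall t \near (0 : R), FM g (gam t) /\ chart_dom c (gam t).1.
Proof.
move=> Xc cw [g0 gFM dx [A dA hA]].
set k := chart_at X w.1 in gFM dx dA hA.
have Xk : atlas X k := chart_at_atlas X w.1.
have kw : chart_dom k w.1 := chart_at_dom X w.1.
have ox : overlap k c (k w.1) by exact: overlap_in.
have kx : chart_img k (k w.1) by exact: overlap_chart_img ox.
set u := w.2 *m x in dx hA.
have AE : A = - christoffel_mx g k (k w.1) u *m w.2.
  apply: mulmx_col_ext => z; rewrite mulNmx mulNmx -mulmxA.
  rewrite (christoffel_mxE g _ _ Xk kx).
  by apply/eqP; rewrite -addr_eq0; apply/eqP; exact: hA.
have nov : \forall t \near (0 : R), overlap k c (k (gam t).1).
  apply: (is_derive_continuous dx); rewrite g0.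
  by apply: open_nbhs_nbhs; split; [exact: overlap_open|].
have nFM : \forall t \near (0 : R), [/\ FM g (gam t), chart_dom k (gam t).1,
    chart_dom c (gam t).1 & overlap k c (k (gam t).1)].
  apply: filterS2 gFM nov => t [Ft kt] ot; split=> //.
  by have [_] := overlapP ot; rewrite chartK.
split; last by apply: filterS nFM => t [].
have Jw : jac_coord k c (k w.1) = jac k c w.1 by rewrite /jac_coord chartK.
have dc : is_derive (0 : R) 1 (fun t => transition k c (k (gam t).1))
    (jac k c w.1 *m u).
  have dT : differentiable (transition k c) (k (gam 0).1).
    rewrite g0; exact: smooth_on_differentiable (transition_smooth Xk Xc) ox.
  apply: (is_derive_eq (is_derive_chain (f := transition k c) dT dx)).
  by rewrite g0 (jac_mul u Xk Xc kw cw).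
have dF : is_derive (0 : R) 1
    (fun t => jac_coord k c (k (gam t).1) *m frame_coord (X := X) k (gam t))
    ('D_u (jac_coord k c) (k w.1) *m w.2 + jac k c w.1 *m A).
  have oT : overlap k c (k (gam 0).1) by rewrite g0.
  have dJ := is_derive_chain_mx (jac_coord_smooth Xk Xc) oT dx.
  apply: (is_derive_eq (is_derive_mulmx dJ dA)).
  by rewrite /= g0 frame_coord_at Jw.
have near_coord : \forall t \near (0 : R),
    (transition k c (k (gam t).1),
     jac_coord k c (k (gam t).1) *m frame_coord (X := X) k (gam t)) =
    coord (X := X) c (gam t).
  apply: filterS nFM => t [_ kt ct _]; rewrite /coord /transition /= chartK //.
  by rewrite (frame_coord_change (X := X) Xk Xc kt ct) /jac_coord chartK.
apply: near_eq_is_derive near_coord _.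
apply: (is_derive_eq (is_derive_pair dc dF)).
have fw : frame_coord (X := X) c w = jac k c w.1 *m w.2.
  by rewrite (frame_coord_change (X := X) Xk Xc kw cw) frame_coord_at.
rewrite /hvec /coord /= fw -mulmxA; congr (_, _).
have := christoffel_mx_change u Xk Xc ox.
rewrite /= Jw /transition /= chartK // => h.
by rewrite mulmxA mulNmx h opprB mulmxBl AE mulNmx mulmxN mulmxA.
Qed.

End HorizontalCurves.

(** * Horizontal and vertical fields in coordinates *)

(** The derivative of the Gram matrix of a parallel frame: the frame has derivative [- C *m A], and
    a metric compatible with the connection has derivative [C^T *m S + S *m C]. *)
Lemma parallel_gram (R : comPzRingType) m n (C S : 'M[R]_m) (A : 'M[R]_(m, n)) :
  ((- C *m A)^T *m S + A^T *m (C^T *m S + S *m C)) *m A +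
  A^T *m S *m (- C *m A) = 0.
Proof.
rewrite trmx_mul linearN /= !(mulNmx, mulmxN) mulmxDr !mulmxDl !mulmxA mulNmx.
by rewrite addKr addrN.
Qed.

Lemma congruence_sym (R : comPzRingType) m n (S : 'M[R]_m) (P : 'M[R]_(m, n)) :
  S^T = S -> (P^T *m S *m P)^T = P^T *m S *m P.
Proof. by move=> SE; rewrite !trmx_mul trmxK SE mulmxA. Qed.

Lemma congruence_comp (R : comPzRingType) m n (S J : 'M[R]_m)
    (P : 'M[R]_(m, n)) (N : 'M[R]_n) :
  (J *m (P *m N))^T *m S *m (J *m (P *m N)) =
  N^T *m (P^T *m (J^T *m S *m J) *m P) *m N.
Proof. by rewrite !trmx_mul !mulmxA. Qed.

Section HorizontalLift.
Context {R : realType} {M : topologicalType} {n : nat}.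
Context {X : @oriented_manifold R M n.+1}.
Variable g : riemannian_metric X.
Implicit Types (k c : @chart R M n.+1) (w : @frame R M n) (p : M).
Implicit Types (x y u : 'cV[R]_n.+1).

Local Notation G c := (form_in_chart X g c).
Local Notation E := ('cV[R]_n.+1 * 'M[R]_n.+1)%type.

Lemma derive_metric_mx c y u : atlas X c -> chart_img c y ->
  'D_u (G c) y = (christoffel_mx g c y u)^T *m G c y +
                 G c y *m christoffel_mx g c y u.
Proof.
move=> Xc cy; have entry (A : 'M[R]_n.+1) i j : A i j = bilin A (basisv i) (basisv j).
  by rewrite /bilin /basisv trmx_delta -rowE -colE !mxE.
apply/matrixP => i j; rewrite !entry.
apply: etrans (christoffel_metric g Xc cy u (basisv i) (basisv j)) _.
rewrite bilinDm -!(christoffel_mxE g _ _ Xc cy).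
by congr (_ + _); rewrite /bilin ?trmx_mul !mulmxA.
Qed.

Lemma horizontal_curve_exists w x : FM g w ->
  exists gam, horizontal_curve g w (w.2 *m x) gam.
Proof.
move=> wFM; set k := chart_at X w.1; set u := w.2 *m x.
have Xk : atlas X k := chart_at_atlas X w.1.
have kw : chart_dom k w.1 := chart_at_dom X w.1.
have kx : chart_img k (k w.1) by exists w.1.
have := FM_coord Xk kw wFM; rewrite /coord /= frame_coord_at => -[ortho dw].
pose C := christoffel_mx g k (k w.1) u.
pose A1 := - C *m w.2.
pose q (t : R) := k w.1 + t *: u.
pose P (t : R) := w.2 + t *: A1.
have dline (W : normedModType R) (a b : W) :
    is_derive (0 : R) 1 (fun t : R => a + t *: b) b.
  have h := is_derive_scale b (is_derive_id (0 : R) 1).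
  by have := is_deriveD (is_derive_cst a (0 : R) 1) h; rewrite add0r scale1r.
have q0 : q 0 = k w.1 by rewrite /q scale0r addr0.
have P0 : P 0 = w.2 by rewrite /P scale0r addr0.
pose S t := (P t)^T *m G k (q t) *m P t.
have dS : is_derive (0 : R) 1 S 0.
  have cq : chart_img k (q 0) by rewrite q0.
  have dG := is_derive_chain (metric_chart_differentiable g Xk cq) (dline _ (k w.1) u).
  have dP := dline _ w.2 A1.
  apply: (is_derive_eq (is_derive_mulmx (is_derive_mulmx (is_derive_tr dP) dG) dP)).
  rewrite /= -/(q 0) -/(P 0) q0 P0.
  rewrite (derive_metric_mx u Xk kx) -/C /A1.
  exact: parallel_gram.
have S0 : S 0 = 1%:M by rewrite /S q0 P0.
have Ssym t : (S t)^T = S t.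
  exact: congruence_sym (form_in_chart_sym g k (q t)).
have [N [N0 dN HN]] := orthonormalize_curve S0 Ssym dS.
pose A t := P t *m N t.
have dA : is_derive (0 : R) 1 A A1.
  apply: (is_derive_eq (is_derive_mulmx (dline _ w.2 A1) dN)).
  by rewrite N0 mulmx1 mulmx0 addr0.
(* A frame is recorded in the preferred chart of its own base point, hence the Jacobian; in the
   chart [k] its matrix is [A t]. *)
pose gam t : @frame R M n :=
  (chart_inv k (q t),
   jac k (chart_at X (chart_inv k (q t))) (chart_inv k (q t)) *m A t).
have nq : \forall t \near (0 : R), chart_img k (q t).
  apply: (is_derive_continuous (dline _ (k w.1) u)); rewrite /= scale0r addr0.
  by apply: open_nbhs_nbhs; split; [exact: chart_img_openP|].
have A0 : A 0 = w.2 by rewrite /A P0 N0 mulmx1.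
have ndet : \forall t \near (0 : R), 0 < \det (A t).
  by apply: (cvgr_gt _ (continuous_det dA)); rewrite A0.
have gcoord t : chart_img k (q t) -> frame_coord (X := X) k (gam t) = A t.
  move=> /chart_imgP[kq _]; rewrite /frame_coord /gam /= mulmxA.
  rewrite (jac_inv Xk (chart_at_atlas X _) kq (chart_at_dom X _)).
  by rewrite mul1mx.
exists gam; split.
- rewrite /gam A0 q0 (chartK kw) -/k (jac_id Xk kw) mul1mx.
  by case: (w).
- apply: filterS3 nq ndet HN => t kq det0 Nt.
  have [kp kpE] := chart_imgP kq; split=> //; split; last first.
    rewrite /gam /= det_mulmx mulr_gt0 //.
    exact: (atlas_oriented Xk (chart_at_atlas X _)) kp (chart_at_dom X _).
  rewrite -Nt /gam /=; exact: congruence_comp.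
- apply: near_eq_is_derive (dline _ (k w.1) u).
  by apply: filterS nq => t /chart_imgP[_ kqE]; rewrite /gam /= kqE.
- exists A1; first by apply: near_eq_is_derive dA; apply: filterS nq => t /gcoord.
  move=> z; rewrite /A1 -mulmxA mulNmx (christoffel_mxE g _ _ Xk kx).
  exact: addNr.
Qed.

(** All horizontal curves have the same velocity in coordinates, so they give the same derivative,
    and at least one exists: [xget] has exactly one candidate. *)
Lemma horizE c w x f (F : E -> R) : FM g w -> atlas X c -> chart_dom c w.1 ->
  differentiable F (coord (X := X) c w) ->
  (forall w', FM g w' -> chart_dom c w'.1 -> f w' = F (coord (X := X) c w')) ->
  horiz g x f w = 'D_(hvec g c (coord (X := X) c w) x) F (coord (X := X) c w).
Proof.
move=> wFM Xc cw dF fF.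
have key gam : horizontal_curve g w (w.2 *m x) gam ->
    is_derive (0 : R) 1 (f \o gam)
      ('D_(hvec g c (coord (X := X) c w) x) F (coord (X := X) c w)).
  move=> hg; have [g0 _ _ _] := hg.
  have [dc nc] := horizontal_curve_coord Xc cw hg.
  have dF' : differentiable F (coord (X := X) c (gam 0)) by rewrite g0.
  have h := is_derive_chain dF' dc; rewrite g0 in h.
  apply: near_eq_is_derive h.
  by apply: filterS nc => t [Ft ct]; rewrite /= fF.
have [gam hg] := horizontal_curve_exists x wFM.
apply: xget_unique; first by exists gam => //; exact: key.
by move=> l [gam' /key[_ <-] [_ <-]].
Qed.

(** [f] and [F] agree only on [FM], so the curve has to stay there: the exponential of a skew matrix
    is orthogonal, and near [t = 0] its determinant is positive. *)
Lemma vertE c w xi f (F : E -> R) : FM g w -> atlas X c -> chart_dom c w.1 ->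
  Defs.skew xi -> differentiable F (coord (X := X) c w) ->
  (forall w', FM g w' -> chart_dom c w'.1 -> f w' = F (coord (X := X) c w')) ->
  vert xi f w = 'D_(vvec (coord (X := X) c w) xi) F (coord (X := X) c w).
Proof.
move=> wFM Xc cw skxi dF fF.
pose B := frame_coord (X := X) c w.
pose a (t : R) := right_action (expmx (t *: xi)) w.
have a0 : a 0 = w by rewrite /a /right_action expmx0 mulmx1; case: (w).
have da : is_derive (0 : R) 1 (fun t => coord (X := X) c (a t))
    (vvec (coord (X := X) c w) xi).
  have h := is_derive_mulmx (is_derive_cst B (0 : R) 1) (is_derive_expmx xi 0).
  rewrite expmx0 mul0mx add0r mulmx1 in h.
  have e : (fun t => coord (X := X) c (a t)) =
      (fun t => (c w.1, B *m expmx (t *: xi))).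
    by apply/funext => t; rewrite /coord /a /right_action /frame_coord /= mulmxA.
  by rewrite e; exact: is_derive_pair (is_derive_cst (c w.1) (0 : R) 1) h.
have dF' : differentiable F (coord (X := X) c (a 0)) by rewrite a0.
have h := is_derive_chain dF' da; rewrite a0 in h.
rewrite /vert derive1E; have [_ <-] := h.
apply: near_eq_derive; apply: filterS (expmx_det_gt0 xi) => t det0.
apply: fF => //; have [ortho dw] := wFM; split; last by rewrite det_mulmx mulr_gt0.
rewrite /= trmx_mul !mulmxA -[_ *m w.2^T *m _]mulmxA -[_ *m (_ *m _) *m w.2]mulmxA.
by rewrite ortho mulmx1 expmx_orthogonal.
Qed.

Lemma vert_funE c w Xi f (F : E -> R) :
  FM g w -> atlas X c -> chart_dom c w.1 ->
  Defs.skew (Xi w) -> differentiable F (coord (X := X) c w) ->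
  (forall w', FM g w' -> chart_dom c w'.1 -> f w' = F (coord (X := X) c w')) ->
  vert_fun Xi f w = 'D_(vvec (coord (X := X) c w) (Xi w)) F (coord (X := X) c w).
Proof.
move=> wFM Xc cw skXi dF fF.
pose L := 'd F (coord (X := X) c w).
pose vv xi := vvec (coord (X := X) c w) xi.
have vvD a b : vv (a + b) = vv a + vv b.
  by rewrite /vv /vvec mulmxDr -[0 in LHS]addr0.
have vvZ r a : vv (r *: a) = r *: vv a.
  by rewrite /vv /vvec -scalemxAr -[0 in LHS](scaler0 _ r).
have Lv xi : L (vv xi) = 'D_(vv xi) F (coord (X := X) c w) by rewrite deriveE.
rewrite -/(vv _) -Lv [in RHS](skew_basis skXi).
rewrite (big_morph vv vvD (_ : vv 0 = 0)); last by rewrite /vv /vvec mulmx0.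
rewrite linear_sum; apply: eq_bigr => i _.
rewrite (big_morph vv vvD (_ : vv 0 = 0)); last by rewrite /vv /vvec mulmx0.
rewrite linear_sum; apply: eq_bigr => j _.
rewrite vvZ linearZ /= Lv; congr (_ * _).
exact: vertE (wedge_skew _ _) dF fF.
Qed.

End HorizontalLift.

(** * Algebra of the contorsion *)

Section ContorsionAlgebra.
Context {R : realType} {n : nat}.
Implicit Types (A Om : 'M[R]_n.+1) (x y z u v : 'cV[R]_n.+1).

Definition contorsion_form Om y : 'M[R]_n.+1 :=
  - 2^-1 *: (dot y (e1 : 'cV[R]_n.+1) *: Om + wedge e1 (Om *m y) +
             wedge (perp y) (Om *m e1)).

Lemma wedgeij u v i j : wedge u v i j = v i 0 * u j 0 - u i 0 * v j 0.
Proof. by rewrite /wedge !mxE !big_ord1 !mxE. Qed.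

Lemma dotC u v : dot u v = dot v u.
Proof.
have -> : dot u v = ((u^T *m v)^T) 0 0 by rewrite mxE.
by rewrite trmx_mul trmxK.
Qed.

Lemma dotDl u v z : dot (u + v) z = dot u z + dot v z.
Proof. by rewrite /dot linearD /= mulmxDl mxE. Qed.

Lemma dotZl (r : R) u z : dot (r *: u) z = r * dot u z.
Proof. by rewrite /dot linearZ /= -scalemxAl mxE. Qed.

Lemma dotBl u v z : dot (u - v) z = dot u z - dot v z.
Proof. by rewrite /dot linearB /= mulmxBl !mxE. Qed.

Lemma dotNl u z : dot (- u) z = - dot u z.
Proof. by rewrite /dot linearN /= mulNmx mxE. Qed.

Lemma dot_skew Om u v : Defs.skew Om -> dot (Om *m u) v = - dot u (Om *m v).
Proof.
by move=> sk; rewrite /dot trmx_mul sk mulmxN mulNmx mxE mulmxA.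
Qed.

Lemma dot_e1 : dot e1 (e1 : 'cV[R]_n.+1) = 1.
Proof. by rewrite /dot /e1 /basisv trmx_delta mul_delta_mx mxE !eqxx. Qed.

(** The derivative at the identity of the rule that conjugation by a rotation carries the wedge of
    two vectors to the wedge of their images. *)
Lemma wedge_comm A u v : Defs.skew A ->
  A *m wedge u v - wedge u v *m A = wedge (A *m u) v + wedge u (A *m v).
Proof.
move=> sk; rewrite /wedge mulmxBr mulmxBl !trmx_mul sk !mulmxN !mulmxA -!mulmxA.
set a := A *m _; set b := A *m _; set c := u *m _; set d := v *m _.
by apply/matrixP => i j; rewrite !mxE; ring.
Qed.



Lemma contorsion_form_mul Om x z : contorsion_form Om x *m z =
  - 2^-1 *: (dot x e1 *: (Om *m z) + dot e1 z *: (Om *m x) -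
    dot (Om *m x) z *: e1 + (dot x z - dot x e1 * dot e1 z) *: (Om *m e1) -
    dot (Om *m e1) z *: (x - dot x e1 *: e1)).
Proof.
rewrite /contorsion_form -scalemxAl 2!mulmxDl -scalemxAl !wedgeE.
by rewrite /perp dotBl dotZl !addrA.
Qed.

Lemma contorsion_form_skew Om x : Defs.skew Om -> Defs.skew (contorsion_form Om x).
Proof.
move=> sk; rewrite /contorsion_form.
have := wedge_skew (perp x) (Om *m e1); have := wedge_skew e1 (Om *m x).
move: (wedge e1 _) (wedge (perp x) _) => W1 W2 s1 s2.
apply/matrixP => i j.
move/matrixP/(_ i j): s1; move/matrixP/(_ i j): s2; move/matrixP/(_ i j): sk.
by rewrite !mxE => -> -> ->; ring.
Qed.

Lemma commute_contorsion Om A x : Defs.skew A ->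
  A *m contorsion_form Om x - contorsion_form Om x *m A =
  - 2^-1 *: (dot x e1 *: (A *m Om - Om *m A) +
     (wedge (A *m e1) (Om *m x) + wedge e1 (A *m (Om *m x))) +
     (wedge (A *m perp x) (Om *m e1) + wedge (perp x) (A *m (Om *m e1)))).
Proof.
move=> skA; rewrite /contorsion_form -scalemxAr -scalemxAl -scalerBr.
congr (_ *: _); rewrite -!wedge_comm // 2!mulmxDr 2!mulmxDl.
rewrite -scalemxAr -scalemxAl scalerBr.
set B1 := _ *: (A *m Om); set B2 := _ *: (Om *m A).
set C1 := A *m wedge e1 _; set C2 := wedge e1 _ *m A.
set D1 := A *m wedge _ _; set D2 := wedge _ _ *m A.
by apply/matrixP => i j; rewrite !mxE; ring.
Qed.

Lemma comm_contorsion Om x : Defs.skew Om ->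
  Om *m contorsion_form Om x - contorsion_form Om x *m Om =
  - 2^-1 *: (wedge (Om *m e1) (Om *m x) + wedge e1 (Om *m (Om *m x)) +
    (wedge (Om *m perp x) (Om *m e1) + wedge (perp x) (Om *m (Om *m e1)))).
Proof. by move=> sk; rewrite commute_contorsion // subrr scaler0 add0r. Qed.

Lemma mul_perp Om x : Om *m perp x = Om *m x - dot x e1 *: (Om *m e1).
Proof. by rewrite /perp mulmxBr -scalemxAr. Qed.

Lemma comm_contorsion_mul Om x z : Defs.skew Om ->
  (Om *m contorsion_form Om x - contorsion_form Om x *m Om) *m z =
  - 2^-1 *: (dot (Om *m e1) z *: (Om *m x) - dot (Om *m x) z *: (Om *m e1) +
    (dot e1 z *: (Om *m (Om *m x)) - dot (Om *m (Om *m x)) z *: e1) +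
    (dot (Om *m perp x) z *: (Om *m e1) - dot (Om *m e1) z *: (Om *m perp x) +
     (dot (perp x) z *: (Om *m (Om *m e1)) -
      dot (Om *m (Om *m e1)) z *: perp x))).
Proof.
move=> sk; rewrite comm_contorsion // -scalemxAl mulmxDl.
by rewrite [X in X + _]mulmxDl [X in _ + X]mulmxDl !wedgeE.
Qed.

Let entD m (A B : 'M[R]_(n.+1, m)) i j : (A + B) i j = A i j + B i j.
Proof. by rewrite mxE. Qed.

Let entN m (A : 'M[R]_(n.+1, m)) i j : (- A) i j = - A i j.
Proof. by rewrite mxE. Qed.

Let entZ m (r : R) (A : 'M[R]_(n.+1, m)) i j : (r *: A) i j = r * A i j.
Proof. by rewrite mxE. Qed.

Section CurvatureAlgebra.
Variables (Om : 'M[R]_n.+1) (sk : Defs.skew Om) (x y : 'cV[R]_n.+1).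

(** The contorsion is linear in [Om], so the quadratic identity below involves only [e1], [x], [y]
    and their images under [Om] and its square. Skewness reduces all inner products between them to
    ten. *)
Let e : 'cV[R]_n.+1 := e1.
Let a := Om *m e.
Let b := Om *m a.
Let p := Om *m x.
Let q := Om *m y.
Let r := Om *m p.
Let s := Om *m q.
Let T := contorsion_form Om.

Let dself u : dot (Om *m u) u = 0.
Proof. by have := dot_skew u u sk; rewrite [dot u _]dotC => h; lra. Qed.

Let pxE : dot p e = - dot a x.
Proof. by rewrite dot_skew // dotC. Qed.

Let qeE : dot q e = - dot a y.
Proof. by rewrite dot_skew // dotC. Qed.

Let ae : dot a e = 0. Proof. exact: dself. Qed.

Let qx : dot q x = - dot p y.
Proof. by rewrite dot_skew // dotC. Qed.

Let tauE : T x *m y - T y *m x = - 2^-1 *: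
  (- (2 * dot p y) *: e - dot a y *: (x - dot x e *: e)
   + dot a x *: (y - dot y e *: e)).
Proof.
rewrite !contorsion_form_mul -/e -/a -/p -/q qx (dotC e x) (dotC e y) (dotC y x).
by apply/colP => i; rewrite !(entD, entN, entZ); ring.
Qed.

Let Tx_e : T x *m e = - 2^-1 *: (dot x e *: a + p + dot a x *: e).
Proof.
rewrite !contorsion_form_mul -/e -/a -/p pxE ae dot_e1.
by apply/colP => i; rewrite !(entD, entN, entZ); ring.
Qed.

Let Tx_q : T x *m q = - 2^-1 *: (dot x e *: s - dot a y *: p - dot p q *: e
  + (- dot p y + dot x e * dot a y) *: a - dot a q *: (x - dot x e *: e)).
Proof.
rewrite !contorsion_form_mul -/e -/a -/p -/s (dotC e q) qeE (dotC x q) qx.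
by apply/colP => i; rewrite !(entD, entN, entZ); ring.
Qed.

Let Tx_a : T x *m a = - 2^-1 *: (dot x e *: b - dot p a *: e + dot a x *: a
  - dot a a *: (x - dot x e *: e)).
Proof.
rewrite !contorsion_form_mul -/e -/a -/p -/b (dotC e a) ae (dotC x a).
by apply/colP => i; rewrite !(entD, entN, entZ); ring.
Qed.

Let Tx_y : T x *m y = - 2^-1 *: (dot x e *: q + dot y e *: p - dot p y *: e
  + (dot x y - dot x e * dot y e) *: a - dot a y *: (x - dot x e *: e)).
Proof. by rewrite !contorsion_form_mul -/e -/a -/p -/q (dotC e y). Qed.

Let Mx_y : (Om *m T x - T x *m Om) *m y = - 2^-1 *: (dot y e *: r + dot p q *: e
  + (dot x y - dot x e * dot y e) *: b + dot a q *: (x - dot x e *: e)).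
Proof.
rewrite comm_contorsion_mul // mul_perp /perp -/e -/a -/p -/r -/b.
rewrite !(dotBl, dotZl) (dotC e y) (dot_skew p y sk) (dot_skew a y sk) -/q.
by apply/colP => i; rewrite !(entD, entN, entZ); ring.
Qed.

Let Mx_e : (Om *m T x - T x *m Om) *m e = - 2^-1 *: (r + dot p a *: e
  + dot a a *: (x - dot x e *: e)).
Proof.
rewrite comm_contorsion_mul // mul_perp /perp -/e -/a -/p -/r -/b.
rewrite !(dotBl, dotZl) (dot_skew p e sk) (dot_skew a e sk) -/a ae pxE dot_e1.
by apply/colP => i; rewrite !(entD, entN, entZ); ring.
Qed.

Let My_x : (Om *m T y - T y *m Om) *m x = - 2^-1 *: (dot x e *: s + dot p q *: e
  + (dot x y - dot x e * dot y e) *: b + dot p a *: (y - dot y e *: e)).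
Proof.
rewrite comm_contorsion_mul // mul_perp /perp -/e -/a -/q -/s -/b.
rewrite !(dotBl, dotZl) (dotC e x) (dot_skew q x sk) (dot_skew a x sk) -/p.
rewrite (dotC y x) (dotC q p) (dotC a p).
by apply/colP => i; rewrite !(entD, entN, entZ); ring.
Qed.

Let My_e : (Om *m T y - T y *m Om) *m e = - 2^-1 *: (s + dot a q *: e
  + dot a a *: (y - dot y e *: e)).
Proof.
rewrite comm_contorsion_mul // mul_perp /perp -/e -/a -/q -/s -/b.
rewrite !(dotBl, dotZl) (dot_skew q e sk) (dot_skew a e sk) -/a ae qeE dot_e1.
rewrite (dotC q a).
by apply/colP => i; rewrite !(entD, entN, entZ); ring.
Qed.

Let Om_tau : Om *m (- 2^-1 *: (- (2 * dot p y) *: e - dot a y *: (x - dot x e *: e)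
   + dot a x *: (y - dot y e *: e))) = - 2^-1 *:
  (- (2 * dot p y) *: a - dot a y *: (p - dot x e *: a)
   + dot a x *: (q - dot y e *: a)).
Proof.
by rewrite -scalemxAr !(mulmxDr, mulmxBr, =^~ scalemxAr, mulmxN).
Qed.

Let tau_e : dot (- 2^-1 *: (- (2 * dot p y) *: e - dot a y *: (x - dot x e *: e)
   + dot a x *: (y - dot y e *: e))) e = dot p y.
Proof. by rewrite !(dotZl, dotDl, dotNl) dot_e1; field. Qed.

(** As [contorsion_form] is linear in [Om], [dT xi] is the derivative of the contorsion along
    [Y_xi]; the vector in the first term is the torsion. *)
Lemma contorsion_curvature_algebra :
  let dT xi := contorsion_form (Om *m xi - xi *m Om) in
  T (T x *m y - T y *m x) - (T x *m T y - T y *m T x) - dT (T x) y + dT (T y) x =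
  4^-1 *:
    (dot (Om *m e1) (Om *m e1) *: wedge (perp x) (perp y)
     + wedge (perp (Om *m Om *m x)) y
     + wedge x (perp (Om *m Om *m y))
     - wedge (Om *m x) (Om *m y)
     - (2 * so_dot Om (wedge x y)) *: Om).
Proof.
move=> dT; have skT z : Defs.skew (T z) by exact: contorsion_form_skew.
(* Each of the four terms is expanded separately, from a trivial equation or a commutator formula,
   into [Om] and wedges of the vectors listed above. *)
have P1 := erefl (T (T x *m y - T y *m x)).
rewrite [X in _ = T X]tauE [in RHS]/T /contorsion_form Om_tau /perp tau_e in P1.
have P2 := commute_contorsion Om y (skT x).
have TO : T x *m Om - Om *m T x = - (Om *m T x - T x *m Om) by rewrite opprB.
have Tx_perp : T x *m perp y = T x *m y - dot y e *: (T x *m e) by exact: mul_perp.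
rewrite TO Tx_perp -/e -/a -/q Tx_y Tx_e Tx_q Tx_a in P2.
have P3 := erefl (dT (T x) y).
rewrite [in RHS]/dT /contorsion_form Mx_y Mx_e in P3.
have P4 := erefl (dT (T y) x).
rewrite [in RHS]/dT /contorsion_form My_x My_e in P4.
have MxE := comm_contorsion x sk.
have MyE := comm_contorsion y sk.
rewrite mul_perp -/T -/e -/a -/p -/q -/r -/s -/b in MxE.
rewrite mul_perp -/T -/e -/a -/p -/q -/r -/s -/b in MyE.
rewrite {}MxE in P2 P3; rewrite {}MyE in P4.
rewrite P1 P2 P3 P4 {P1 P2 P3 P4}.
rewrite (so_dot_wedge _ _ sk) -!mulmxA.
rewrite /perp -/e -/a -/p -/q -/r -/s.
rewrite (dot_skew p e sk) (dot_skew q e sk) -/a (dotC q a).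
(* Skewness has done its work: with the vectors and the inner products turned into independent
   variables, the identity still holds entry by entry. *)
move: wedgeij; move: (@wedge R n.+1) => W.
move: (dot x e) (dot y e) (dot p y) (dot a x) (dot a y) (dot p q) (dot p a)
  (dot a q) (dot a a) (dot x y) => xe ye k ax ay pq pa aq N xy.
move: (s) (r) (q) (p) (b) (a) (e) => s' r' q' p' b' a' e' WE.
apply/matrixP => i j; rewrite !(mxE, WE).
by field.
Qed.

End CurvatureAlgebra.
End ContorsionAlgebra.

(** * Linearity of the contorsion and its values on the basis *)

Section LinearMaps.
Context {R : realType} {V : normedModType R}.

Lemma is_derive_linmx (W : normedModType R) m n (L : 'M[R]_(m, n) -> W)
    (M : V -> 'M[R]_(m, n)) x v dM :
  linear L -> is_derive x v M dM -> is_derive x v (fun y => L (M y)) (L dM).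
Proof.
move=> hL /is_derive_mxP dMij.
pose L' : {linear 'M[R]_(m, n) -> W} :=
  HB.pack L (GRing.isLinear.Build _ _ _ _ L hL).
have LE A : L A = \sum_i \sum_j A i j *: L (delta_mx i j).
  rewrite -[L]/(L' : _ -> _) [in LHS](matrix_sum_delta A) linear_sum.
  apply: eq_bigr => i _; rewrite linear_sum; apply: eq_bigr => j _.
  exact: linearZ.
rewrite LE (_ : (fun _ => _) =
    fun y => \sum_i \sum_j M y i j *: L (delta_mx i j)); last first.
  by apply/funext => y; exact: LE.
apply: is_derive_sum_in => i _; apply: is_derive_sum_in => j _.
exact: is_derive_scale.
Qed.

Lemma smooth_linmx m n p q (U : set V) (L : 'M[R]_(m, n) -> 'M[R]_(p, q))
    (M : V -> 'M[R]_(m, n)) : open U ->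
  linear L -> smooth_mx_on U M -> smooth_mx_on U (fun x => L (M x)).
Proof.
move=> oU hL sM.
pose L' : {linear 'M[R]_(m, n) -> 'M[R]_(p, q)} :=
  HB.pack L (GRing.isLinear.Build _ _ _ _ L hL).
have LE A : L A = \sum_i \sum_j A i j *: L (delta_mx i j).
  rewrite -[L]/(L' : _ -> _) [in LHS](matrix_sum_delta A) linear_sum.
  apply: eq_bigr => i _; rewrite linear_sum; apply: eq_bigr => j _.
  exact: linearZ.
move=> k l; apply: (@smooth_on_ext _ _ _ _
    (fun x => (\sum_i \sum_j M x i j *: L (delta_mx i j)) k l)) => //.
  by move=> x _; rewrite LE.
apply: smooth_mx_sum => // i _; apply: smooth_mx_sum => // j _.
by apply: smooth_mx_scale => //; exact: smooth_mx_cst.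
Qed.

Lemma smooth_mx_ext m n (U : set V) (A B : V -> 'M[R]_(m, n)) : open U ->
  (forall x, U x -> A x = B x) -> smooth_mx_on U A -> smooth_mx_on U B.
Proof.
by move=> oU AB sA i j; apply: smooth_on_ext (sA i j) => // x /AB ->.
Qed.

End LinearMaps.

Lemma contorsion_form_linear (R : realType) n x :
  linear (fun Om : 'M[R]_n.+1 => contorsion_form Om x).
Proof.
move=> r A B; rewrite /contorsion_form !mulmxDl -!scalemxAl.
have wl u (v w : 'cV[R]_n.+1) : wedge u (r *: v + w) = r *: wedge u v + wedge u w.
  by apply/matrixP => i j; rewrite !(wedgeij, mxE); ring.
rewrite !wl; move: (wedge e1 _) (wedge e1 _) (wedge (perp x) _) (wedge (perp x) _).
by move=> W1 W2 W3 W4; apply/matrixP => i j; rewrite !mxE; ring.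
Qed.

Lemma contorsion_formB (R : realType) n (A B : 'M[R]_n.+1) x :
  contorsion_form (A - B) x = contorsion_form A x - contorsion_form B x.
Proof.
have := contorsion_form_linear x (-1) B A; rewrite !scaleN1r.
by rewrite [- B + A]addrC [- contorsion_form B x + _]addrC.
Qed.

Lemma linear_basisv (R : realType) n (W : lmodType R) (L : 'cV[R]_n -> W) x :
  linear L -> L x = \sum_l x l 0 *: L (basisv l).
Proof.
move=> hL.
pose L' : {linear 'cV[R]_n -> W} := HB.pack L (GRing.isLinear.Build _ _ _ _ _ hL).
rewrite -[L]/(L' : _ -> _) [in LHS](sum_basisv x) linear_sum.
by apply: eq_bigr => l _; exact: linearZ.
Qed.

Lemma contorsion_form_sum (R : realType) n (Om : 'M[R]_n.+1) x :
  contorsion_form Om x = \sum_l x l 0 *: contorsion_form Om (basisv l).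
Proof.
apply: linear_basisv => r u v; rewrite /contorsion_form /perp dotDl dotZl.
rewrite !mulmxDr -!scalemxAr.
move: (Om *m u) (Om *m v) (Om *m e1) (e1) => a b c e.
move: (@wedgeij R n); move: (@wedge R n.+1) => W WE.
by apply/matrixP => i j; rewrite !(mxE, WE); ring.
Qed.

(** The right-hand side is minus [tOm], so [magnetic_field] is the direction [mvec] at [e1]. *)
Lemma contorsion_form_e1 (R : realType) n (Om : 'M[R]_n.+1) :
  contorsion_form Om e1 =
  - (wedge e1 (Om *m e1) + 2^-1 *: (Om - wedge e1 (Om *m e1))).
Proof.
rewrite /contorsion_form dot_e1 scale1r /perp dot_e1 scale1r subrr.
have -> : wedge 0 (Om *m e1) = 0 :> 'M[R]_n.+1.
  by rewrite /wedge trmx0 mulmx0 mul0mx subrr.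
by move: (wedge _ _) => W; apply/matrixP => i j; rewrite !mxE; field.
Qed.

(** This is the vertical part of the bracket of the magnetic field with [Y_xi]. The commutator comes
    from multiplying the frame by [xi], the last term from the variation of [Om] along [Y_xi]. Their
    terms in the commutator of [Om] and [xi] cancel, and [xi] turns [e1] into the basis vector. *)
Lemma contorsion_form_vertical (R : realType) n (Om : 'M[R]_n.+1) j :
  Defs.skew Om -> j != ord0 ->
  let xi := wedge e1 (basisv j) in
  xi *m contorsion_form Om e1 - contorsion_form Om e1 *m xi +
    contorsion_form (Om *m xi - xi *m Om) e1 = contorsion_form Om (basisv j).
Proof.
move=> sk j0 xi.
have skxi : Defs.skew xi by exact: wedge_skew.
have je : dot (basisv j) e1 = 0 :> R.
  rewrite /dot /e1 /basisv trmx_delta mul_delta_mx_cond.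
  by rewrite (negbTE j0) mulr0n mxE.
have xe : xi *m e1 = basisv j.
  by rewrite /xi wedgeE dot_e1 je scale1r scale0r subr0.
have pj : perp (basisv j : 'cV[R]_n.+1) = basisv j.
  by rewrite /perp je scale0r subr0.
have pe : perp (e1 : 'cV[R]_n.+1) = 0 by rewrite /perp dot_e1 scale1r subrr.
have w0 u : wedge 0 u = 0 :> 'M[R]_n.+1.
  by rewrite /wedge trmx0 mulmx0 mul0mx subrr.
rewrite (commute_contorsion Om e1 skxi) /contorsion_form pe pj mulmx0 !w0 je dot_e1.
clearbody xi; rewrite xe mulmxBl -!mulmxA xe.
have wB u v z : wedge u (v - z) = wedge u v - wedge u z :> 'M[R]_n.+1.
  by apply/matrixP => a b; rewrite !(wedgeij, mxE); ring.
rewrite wB.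
move: (Om *m xi) (xi *m Om) (wedge e1 _) (wedge e1 _) (wedge (basisv j) _).
by move=> A B W1 W2 W3; apply/matrixP => a b; rewrite !mxE; field.
Qed.

(** * The magnetic fields in coordinates *)

Section MagneticFields.
Context {R : realType} {M : topologicalType} {n : nat}.
Context {X : @oriented_manifold R M n.+1}.
Variables (g : riemannian_metric X) (Om : two_form X).
Implicit Types (c : @chart R M n.+1) (w : @frame R M n).
Implicit Types (x y u : 'cV[R]_n.+1).

Local Notation G c := (form_in_chart X g c).
Local Notation E := ('cV[R]_n.+1 * 'M[R]_n.+1)%type.
Local Notation coord := (coord (X := X)).

(** A smooth extension of [bOm] to all pairs over the chart, orthonormal or not, so that it can be
    differentiated in every direction. *)
Definition Omega_coord c (q : E) : 'M[R]_n.+1 :=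
  q.2^T *m (form_in_chart X Om c q.1)^T *m q.2.

(** On an orthonormal frame the inverse of [w.2] is [w.2^T *m g w.1], which cancels the inverse of
    the metric. What remains is polynomial in the frame and transforms like a bilinear form. *)
Lemma bOm_frame w : FM g w -> bOm g Om w = w.2^T *m (Om w.1)^T *m w.2.
Proof.
move=> [ortho _]; rewrite /bOm /form_endo.
have [u2 iE] : w.2 \in unitmx /\ invmx w.2 = w.2^T *m g w.1.
  have [_ u2] := mulmx1_unit ortho; split=> //.
  by rewrite -[RHS](mulmxK u2) ortho mul1mx.
by rewrite iE !mulmxA mulmxK // metric_unit.
Qed.

Lemma bOm_skew w : FM g w -> Defs.skew (bOm g Om w).
Proof.
move=> wFM; rewrite (bOm_frame wFM) /Defs.skew !trmx_mul !trmxK mulmxA.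
by rewrite (form_skew Om w.1) mulmxN mulNmx opprK.
Qed.

Lemma bOm_coord c w : atlas X c -> FM g w -> chart_dom c w.1 ->
  bOm g Om w = Omega_coord c (coord c w).
Proof.
move=> Xc wFM cw; rewrite (bOm_frame wFM) /Omega_coord /coord /=.
rewrite /form_in_chart (chartK cw) /frame_coord.
have tr3 (K O : 'M[R]_n.+1) : (K^T *m O *m K)^T = K^T *m O^T *m K.
  by rewrite !trmx_mul trmxK mulmxA.
rewrite tr3; apply/esym/congruence_cancel.
exact: jac_inv (chart_at_atlas X w.1) Xc (chart_at_dom X w.1) cw.
Qed.

Definition dom_coord c : set E := [set q | chart_img c q.1].

Lemma fst_continuous : continuous (fst : E -> 'cV[R]_n.+1).
Proof. by move=> q; exact: cvg_fst. Qed.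

Lemma snd_continuous : continuous (snd : E -> 'M[R]_n.+1).
Proof. by move=> q; exact: cvg_snd. Qed.

Lemma dom_coord_open c : open (dom_coord c).
Proof.
apply: open_comp; last exact: chart_img_openP.
by move=> q _; exact: fst_continuous.
Qed.

Lemma smooth_snd c : smooth_mx_on (dom_coord c) (fun q : E => q.2).
Proof.
apply: smooth_on_mx; first exact: dom_coord_open.
exact: (smooth_on_lin _ snd_continuous).
Qed.

Lemma smooth_fst c m m' (A : 'cV[R]_n.+1 -> 'M[R]_(m, m')) :
  smooth_mx_on (chart_img c) A -> smooth_mx_on (dom_coord c) (fun q : E => A q.1).
Proof.
move=> sA i j.
exact: (smooth_on_comp_lin fst_continuous (@chart_img_openP _ _ _ c) (sA i j)).
Qed.

Lemma is_derive_fst (q v : E) : is_derive q v (fun q : E => q.1) v.1.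
Proof. exact: (is_derive_lin q v fst_continuous). Qed.

Lemma is_derive_snd (q v : E) : is_derive q v (fun q : E => q.2) v.2.
Proof. exact: (is_derive_lin q v snd_continuous). Qed.

Lemma Omega_coord_smooth c : atlas X c ->
  smooth_mx_on (dom_coord c) (Omega_coord c).
Proof.
move=> Xc; have oU := @dom_coord_open c.
have s2 := @smooth_snd c.
have sO : smooth_mx_on (chart_img c) (form_in_chart X Om c).
  by apply: smooth_on_mx; [exact: chart_img_openP|exact: form_smooth].
have sOt := smooth_mx_tr oU (smooth_fst sO).
exact: (smooth_mx_mul oU (smooth_mx_mul oU (smooth_mx_tr oU s2) sOt) s2).
Qed.

Lemma christoffel_mx_smooth c u : atlas X c ->
  smooth_mx_on (chart_img c) (fun y => christoffel_mx g c y u).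
Proof.
move=> Xc; have oU := @chart_img_openP _ _ _ c.
have sG := metric_chart_smooth g Xc.
have sDG v : smooth_mx_on (chart_img c) ('D_v (G c)).
  by apply: smooth_on_mx => //; apply: smooth_on_derive; exact: metric_smooth.
have sb (A : 'cV[R]_n.+1 -> 'M[R]_n.+1) v z :
    smooth_mx_on (chart_img c) A ->
    smooth_on (chart_img c) (fun y => bilin (A y) v z).
  move=> sA; apply: (@smooth_mx_mul _ _ _ _ _ _ (fun y => v^T *m A y)) => //.
  - by apply: smooth_mx_mul => //; exact: smooth_mx_cst.
  - exact: smooth_mx_cst.
move=> i j.
have h : smooth_mx_on (chart_img c) (fun y => christoffel g c y u (basisv j)).
  apply: smooth_mx_mul => //.
    by apply: smooth_mx_inv => // y cy; exact: form_in_chart_unit.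
  move=> k l; apply: (@smooth_on_ext _ _ _ _ (fun x => 2^-1 *
    (bilin ('D_u (G c) x) (basisv j) (basisv k) +
     bilin ('D_(basisv j) (G c) x) u (basisv k) -
     bilin ('D_(basisv k) (G c) x) u (basisv j)))) => //.
    by move=> x _; rewrite mxE.
  apply: smooth_onM => //; first exact: smooth_on_cst.
  apply: smooth_onD => //; last by apply: smooth_onN => //; exact: sb.
  by apply: smooth_onD => //; exact: sb.
by apply: smooth_on_ext (h i 0) => // y _; rewrite /christoffel_mx [RHS]mxE.
Qed.

Definition mvec c (q : E) x : E :=
  hvec g c q x - vvec q (contorsion_form (Omega_coord c q) x).

Lemma mvec1 c q x : (mvec c q x).1 = q.2 *m x.
Proof. by rewrite /mvec /= subr0. Qed.

Lemma mvec2 c q x : (mvec c q x).2 = - (christoffel_mx g c q.1 (q.2 *m x) *m q.2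
   + q.2 *m contorsion_form (Omega_coord c q) x).
Proof. by rewrite /mvec /= mulNmx opprD. Qed.

Lemma christoffel_field_smooth c x : atlas X c ->
  smooth_mx_on (dom_coord c) (fun q : E => christoffel_mx g c q.1 (q.2 *m x)).
Proof.
move=> Xc; have oU := @dom_coord_open c; have s2 := @smooth_snd c.
apply: (@smooth_mx_ext _ _ _ _ _ (fun q : E =>
    \sum_l (q.2 *m x) l 0 *: christoffel_mx g c q.1 (basisv l))) => //.
  by move=> q cq; rewrite -christoffel_mx_sum.
apply: smooth_mx_sum => // l _; apply: smooth_mx_scale => //.
  apply: (@smooth_mx_mul _ _ _ _ _ _ (fun q : E => q.2) (fun=> x)) => //.
  exact: smooth_mx_cst.
by apply: (@smooth_fst c _ _ (fun y => christoffel_mx g c y (basisv l)));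
  exact: christoffel_mx_smooth.
Qed.

Lemma contorsion_coord_smooth c x : atlas X c ->
  smooth_mx_on (dom_coord c) (fun q : E => contorsion_form (Omega_coord c q) x).
Proof.
move=> Xc; apply: (smooth_linmx (@dom_coord_open c) (contorsion_form_linear x)).
exact: Omega_coord_smooth.
Qed.

Lemma mvec2_smooth c x : atlas X c ->
  smooth_mx_on (dom_coord c) (fun q => (mvec c q x).2).
Proof.
move=> Xc; have oU := @dom_coord_open c; have s2 := @smooth_snd c.
apply: (@smooth_mx_ext _ _ _ _ _ (fun q : E =>
   - (christoffel_mx g c q.1 (q.2 *m x) *m q.2
      + q.2 *m contorsion_form (Omega_coord c q) x))) => //.
  by move=> q _; rewrite mvec2.
apply: smooth_mx_opp => //; apply: smooth_mx_add => //; apply: smooth_mx_mul => //.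
  exact: christoffel_field_smooth.
exact: contorsion_coord_smooth.
Qed.

Lemma mvec2_sum c q x : atlas X c -> dom_coord c q ->
  (mvec c q x).2 = \sum_l x l 0 *: (mvec c q (basisv l)).2.
Proof.
move=> Xc cq.
have L : linear (fun x => christoffel_mx g c q.1 (q.2 *m x)).
  have CL : linear (christoffel_mx g c q.1).
    move=> r u v; rewrite (christoffel_mx_sum g (r *: u + v) Xc cq).
    rewrite (christoffel_mx_sum g u Xc cq) (christoffel_mx_sum g v Xc cq).
    rewrite scaler_sumr -big_split; apply: eq_bigr => l _ /=.
    by rewrite !mxE scalerDl scalerA.
  by move=> r u v; rewrite mulmxDr -scalemxAr CL.
have TE := contorsion_form_sum (Omega_coord c q) x.
apply: etrans (mvec2 c q x) _.
apply: etrans (congr2 (fun P Q => - (P *m q.2 + q.2 *m Q)) (linear_basisv x L) TE) _.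
rewrite mulmx_suml mulmx_sumr -big_split -sumrN; apply: eq_bigr => l _ /=.
rewrite -scalemxAl -scalemxAr -scalerDr -scalerN; congr (_ *: _).
exact: esym (mvec2 c q (basisv l)).
Qed.

End MagneticFields.

(** * First derivatives of the magnetic fields in coordinates *)

Section Contorsion.
Context {R : realType} {M : topologicalType} {n : nat}.
Context {X : @oriented_manifold R M n.+1}.
Variables (g : riemannian_metric X) (Om : two_form X).
Implicit Types (c : @chart R M n.+1) (w : @frame R M n).
Implicit Types (x y u : 'cV[R]_n.+1).

Local Notation E := ('cV[R]_n.+1 * 'M[R]_n.+1)%type.
Local Notation coord := (coord (X := X)).
Local Notation Omega_coord := (Omega_coord Om).
Local Notation mvec := (mvec g Om).

Lemma coord_dom c w : chart_dom c w.1 -> dom_coord c (coord c w).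
Proof. by exists w.1. Qed.

(** The part of the derivative of C(u) along [v] that comes from the base point, with [u] held
    fixed. *)
Definition dchristoffel c y v u : 'M[R]_n.+1 :=
  \sum_l u l 0 *: 'D_v (fun z => christoffel_mx g c z (basisv l)) y.

Lemma is_derive_christoffel c (q v : E) x : atlas X c -> dom_coord c q ->
  is_derive q v (fun q : E => christoffel_mx g c q.1 (q.2 *m x))
    (christoffel_mx g c q.1 (v.2 *m x) + dchristoffel c q.1 v.1 (q.2 *m x)).
Proof.
move=> Xc cq.
have nq : \forall r \near q, dom_coord c r.
  by apply: open_nbhs_nbhs; split=> //; exact: dom_coord_open.
have e : \forall r \near q,
    \sum_l (r.2 *m x) l 0 *: christoffel_mx g c r.1 (basisv l) =
    christoffel_mx g c r.1 (r.2 *m x).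
  by apply: filterS nq => r cr; rewrite [RHS]christoffel_mx_sum.
apply: near_eq_is_derive e _.
rewrite (christoffel_mx_sum g _ Xc cq) /dchristoffel -big_split /=.
apply: is_derive_sum_in => l _.
have dC := is_derive_chain_mx (christoffel_mx_smooth g (basisv l) Xc) cq (is_derive_fst q v).
have dx := is_derive_mulmx (is_derive_snd q v) (is_derive_cst x q v).
rewrite mulmx0 addr0 in dx; move/is_derive_mxP/(_ l 0): dx => dx.
exact: is_derive_scalemx dx dC.
Qed.

Lemma is_derive_contorsion c (q v : E) x : atlas X c -> dom_coord c q ->
  is_derive q v (fun q : E => contorsion_form (Omega_coord c q) x)
    (contorsion_form ('D_v (Omega_coord c) q) x).
Proof.
move=> Xc cq; apply: (is_derive_linmx (contorsion_form_linear x)).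
exact: is_derive_smooth_mx (Omega_coord_smooth Om Xc) cq.
Qed.

Lemma is_derive_mvec2 c (q v : E) x : atlas X c -> dom_coord c q ->
  is_derive q v (fun q : E => (mvec c q x).2)
    (- ((christoffel_mx g c q.1 (v.2 *m x) +
         dchristoffel c q.1 v.1 (q.2 *m x)) *m q.2 +
        christoffel_mx g c q.1 (q.2 *m x) *m v.2 +
        (v.2 *m contorsion_form (Omega_coord c q) x +
         q.2 *m contorsion_form ('D_v (Omega_coord c) q) x))).
Proof.
move=> Xc cq.
have e : (fun q : E => (mvec c q x).2) = (fun q : E =>
    - (christoffel_mx g c q.1 (q.2 *m x) *m q.2 +
       q.2 *m contorsion_form (Omega_coord c q) x)).
  by apply/funext => r; exact: mvec2.
rewrite e; apply: is_deriveN; apply: is_deriveD.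
  exact: is_derive_mulmx (is_derive_christoffel v x Xc cq) (is_derive_snd q v).
exact: is_derive_mulmx (is_derive_snd q v) (is_derive_contorsion v x Xc cq).
Qed.

(** Multiplying the frame on the right by a rotation conjugates Omega; this is the infinitesimal
    form. *)
Lemma derive_Omega_vert c (q : E) xi : atlas X c -> dom_coord c q ->
  Defs.skew xi ->
  'D_(vvec q xi) (Omega_coord c) q =
  Omega_coord c q *m xi - xi *m Omega_coord c q.
Proof.
move=> Xc cq skxi.
have sO : smooth_mx_on (chart_img c) (form_in_chart X Om c).
  by apply: smooth_on_mx; [exact: chart_img_openP|exact: form_smooth].
have d2 := is_derive_snd q (vvec q xi).
have dO := is_derive_chain_mx sO cq (is_derive_fst q (vvec q xi)).
rewrite /= derive0 in dO.
have [_ h] := is_derive_mulmx (is_derive_mulmx (is_derive_tr d2) (is_derive_tr dO)) d2.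
apply: etrans h _; rewrite /= trmx0 mulmx0 addr0 trmx_mul skxi.
by rewrite /Omega_coord !mulNmx addrC !mulmxA.
Qed.

Section Entries.
Variables (m m' : nat) (c : @chart R M n.+1) (Phi : E -> 'M[R]_(m, m')).
Variables (f : @frame R M n -> R) (i : 'I_m) (j : 'I_m').
Hypotheses (Xc : atlas X c) (sPhi : smooth_mx_on (dom_coord c) Phi).
Hypothesis fE : forall w, FM g w -> chart_dom c w.1 -> f w = Phi (coord c w) i j.

Let entry (q : E) : R := Phi q i j.

Let dentry q : dom_coord c q -> differentiable entry q.
Proof. exact: smooth_on_differentiable (sPhi i j). Qed.

Let entryE q v : dom_coord c q -> 'D_v entry q = ('D_v Phi q) i j.
Proof.
move=> cq; have /is_derive_mxP/(_ i j) := is_derive_smooth_mx v sPhi cq.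
by case.
Qed.

Lemma horiz_entry x w : FM g w -> chart_dom c w.1 ->
  horiz g x f w = ('D_(hvec g c (coord c w) x) Phi (coord c w)) i j.
Proof.
move=> wFM cw; have cq := coord_dom cw.
exact: etrans (horizE x wFM Xc cw (dentry cq) fE) (entryE _ cq).
Qed.

Lemma vert_entry xi w : FM g w -> chart_dom c w.1 -> Defs.skew xi ->
  vert xi f w = ('D_(vvec (coord c w) xi) Phi (coord c w)) i j.
Proof.
move=> wFM cw skxi; have cq := coord_dom cw.
exact: etrans (vertE wFM Xc cw skxi (dentry cq) fE) (entryE _ cq).
Qed.

Lemma vert_fun_entry Xi w : FM g w -> chart_dom c w.1 -> Defs.skew (Xi w) ->
  vert_fun Xi f w = ('D_(vvec (coord c w) (Xi w)) Phi (coord c w)) i j.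
Proof.
move=> wFM cw skxi; have cq := coord_dom cw.
exact: etrans (vert_funE wFM Xc cw skxi (dentry cq) fE) (entryE _ cq).
Qed.

Lemma smooth_near_entry w : chart_dom c w.1 -> smooth_near g f w.
Proof.
move=> cw; exists c; split=> //; exists (dom_coord c), entry; split.
- exact: dom_coord_open.
- exact: coord_dom.
- exact: sPhi.
- by move=> w' wFM' cw' _; exact: fE.
Qed.

Lemma horiz_sub_vert_entry x Xi w : FM g w -> chart_dom c w.1 ->
  Defs.skew (Xi w) ->
  horiz g x f w - vert_fun Xi f w =
  ('D_(hvec g c (coord c w) x - vvec (coord c w) (Xi w)) Phi (coord c w)) i j.
Proof.
move=> wFM cw skXi; have cq := coord_dom cw; have df := dentry cq.
rewrite (horizE x wFM Xc cw df fE) (vert_funE wFM Xc cw skXi df fE).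
rewrite -(entryE _ cq) !deriveE // -linearB.
by [].
Qed.

Lemma magnetic_entry w : FM g w -> chart_dom c w.1 ->
  magnetic_field g Om f w = ('D_(mvec c (coord c w) e1) Phi (coord c w)) i j.
Proof.
move=> wFM cw.
have skB := bOm_skew Om wFM.
have tE : tOm g Om w = - contorsion_form (bOm g Om w) e1.
  by rewrite contorsion_form_e1 opprK.
(* [vert_fun] uses only the value of its argument at [w], so a constant function serves. *)
pose Xi (_ : @frame R M n) := contorsion_form (bOm g Om w) e1.
have skXi : Defs.skew (Xi w) by exact: contorsion_form_skew.
have := horiz_sub_vert_entry e1 wFM cw skXi.
rewrite /Xi (bOm_coord Om Xc wFM cw) -/(mvec c (coord c w) e1) => <-.
rewrite /magnetic_field -(bOm_coord Om Xc wFM cw); congr (_ + _).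
rewrite /vert_fun -sumrN; apply: eq_bigr => k _; rewrite -sumrN.
apply: eq_bigr => l _; rewrite tE -mulNr; congr (_ * _).
by rewrite /so_dot mulNmx linearN /= mulrN.
Qed.

End Entries.

End Contorsion.

(** * The contorsion *)

Section ContorsionFormula.
Context {R : realType} {M : topologicalType} {n : nat}.
Context {X : @oriented_manifold R M n.+1}.
Variables (g : riemannian_metric X) (Om : two_form X).
Implicit Types (c : @chart R M n.+1) (w : @frame R M n).
Implicit Types (x y u : 'cV[R]_n.+1).

Local Notation E := ('cV[R]_n.+1 * 'M[R]_n.+1)%type.
Local Notation coord := (coord (X := X)).
Local Notation frame_coord := (frame_coord (X := X)).
Local Notation Omega_coord := (Omega_coord Om).
Local Notation mvec := (mvec g Om).

Lemma dchristoffel0 c y u : dchristoffel g c y 0 u = 0.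
Proof.
by rewrite /dchristoffel big1 // => l _; rewrite derive0 scaler0.
Qed.

(** [C0] and [C1] stand for C(A e1) and C(A xi e1), [D0] for the derivative of C in the base
    direction, which is zero for a vertical field, [T1] and [T2] for the contorsions of [e1] and of
    the basis vector, and [dT] for the derivative of [T1] along [Y_xi]. *)
Let vertical_bracket (A D0 C0 C1 T1 T2 xi dT : 'M[R]_n.+1) :
  xi *m T1 - T1 *m xi + dT = T2 -> D0 = 0 ->
  - (- (C0 *m A + A *m T1) *m xi -
     - ((C1 + D0) *m A + C0 *m (A *m xi) + (A *m xi *m T1 + A *m dT))) =
  - (C1 *m A + A *m T2).
Proof.
move=> <- ->; rewrite mulNmx mulmxDl !(mulmxDr, mulmxN) addr0 !mulmxA.
move: (C0 *m A *m xi) (A *m T1 *m xi) (C1 *m A) (A *m xi *m T1) (A *m dT).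
by move=> a b d e f; apply/matrixP => i j; rewrite !mxE; ring.
Qed.

Let entry_oppB (P Q S : 'M[R]_n.+1) i j : - (P - Q) = S ->
  - (P i j - Q i j) = S i j.
Proof. by move=> <-; rewrite !mxE. Qed.

Lemma mag_horiz_basis_frame c w l i j : atlas X c -> FM g w ->
  chart_dom c w.1 ->
  mag_horiz_basis g Om l (fun w' => frame_coord c w' i j) w =
  (mvec c (coord c w) (basisv l)).2 i j.
Proof.
move=> Xc wFM cw; set f := fun w' => _.
have cq : dom_coord c (coord c w) := coord_dom cw; have oU := @dom_coord_open _ _ _ c.
have Dsnd (q v : E) : 'D_v (fun q : E => q.2) q = v.2.
  by have [] := is_derive_snd q v.
have fE w' : FM g w' -> chart_dom c w'.1 -> f w' = (coord c w').2 i j by [].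
have s2 := @smooth_snd _ _ _ c.
(* The inner derivatives in the bracket are identified at every frame over the chart, because the
   outer field differentiates them. *)
have magf w' : FM g w' -> chart_dom c w'.1 ->
    magnetic_field g Om f w' = (mvec c (coord c w') e1).2 i j.
  by move=> wFM' cw'; rewrite (magnetic_entry Om Xc s2 fE) // Dsnd.
rewrite /mag_horiz_basis; case: eqP => [->|/eqP l0]; first exact: magf.
set xi := wedge e1 (basisv l).
have skxi : Defs.skew xi by exact: wedge_skew.
have vf w' : FM g w' -> chart_dom c w'.1 ->
    vert xi f w' = ((coord c w').2 *m xi) i j.
  by move=> wFM' cw'; rewrite (vert_entry Xc s2 fE) // Dsnd.
have s2xi : smooth_mx_on (dom_coord c) (fun q : E => q.2 *m xi).
  by apply: smooth_mx_mul => //; exact: smooth_mx_cst.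
have sm := mvec2_smooth g Om e1 Xc.
rewrite /vfield_bracket (magnetic_entry Om Xc s2xi vf) //.
rewrite (vert_entry Xc sm magf) //.
set q := coord c w.
have [_ ->] := is_derive_mvec2 g Om (vvec q xi) e1 Xc cq.
have [_ h] := is_derive_mulmx (is_derive_snd q (mvec c q e1))
  (is_derive_cst xi q (mvec c q e1)).
rewrite mulmx0 addr0 in h; rewrite h.
have skB : Defs.skew (Omega_coord c q).
  by rewrite -(bOm_coord Om Xc wFM cw); exact: bOm_skew.
have xe : xi *m e1 = basisv l.
  have le : dot (basisv l) e1 = 0 :> R.
    rewrite /dot /e1 /basisv trmx_delta mul_delta_mx_cond.
    by rewrite (negbTE l0) mulr0n mxE.
  by rewrite /xi wedgeE dot_e1 le scale1r scale0r subr0.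
rewrite (derive_Omega_vert Om Xc cq skxi); apply: entry_oppB.
have vb := vertical_bracket q.2 (christoffel_mx g c q.1 (q.2 *m e1))
  (christoffel_mx g c q.1 (q.2 *m xi *m e1))
  (contorsion_form_vertical skB l0) (dchristoffel0 c q.1 (q.2 *m e1)).
have xe' : q.2 *m xi *m e1 = q.2 *m basisv l by rewrite -mulmxA xe.
apply: etrans _ (esym (mvec2 g Om c q (basisv l))).
rewrite -xe'; apply: etrans _ vb.
exact: (congr1 (fun P => - (P *m xi - _)) (mvec2 g Om c q e1)).
Qed.

Lemma mag_horiz_frame c w x i j : atlas X c -> FM g w -> chart_dom c w.1 ->
  mag_horiz g Om (cst x) (fun w' => frame_coord c w' i j) w =
  (mvec c (coord c w) x).2 i j.
Proof.
move=> Xc wFM cw; rewrite (mvec2_sum g Om x Xc (coord_dom cw)) summxE.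
apply: eq_bigr => l _; rewrite mag_horiz_basis_frame // [RHS]mxE.
by congr (_ * _); rewrite /cst /dot /basisv -colE !mxE.
Qed.

Variable T : 'cV[R]_n.+1 -> @frame R M n -> 'M[R]_n.+1.
Hypothesis hT : is_contorsion g Om T.

(** On the entries of [A] both descriptions of the field have the same horizontal part; what is left
    is [A] times the contorsion, and [A] is invertible. *)
Lemma contorsionE x w : FM g w -> T x w = contorsion_form (bOm g Om w) x.
Proof.
move=> wFM; set c := chart_at X w.1.
have Xc : atlas X c := chart_at_atlas X w.1.
have cw : chart_dom c w.1 := chart_at_dom X w.1.
have s2 := @smooth_snd _ _ _ c.
have [skT eqT] := hT x.
have key i j : (mvec c (coord c w) x).2 i j =
    (hvec g c (coord c w) x - vvec (coord c w) (T x w)).2 i j.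
  have fE w' : FM g w' -> chart_dom c w'.1 ->
    frame_coord c w' i j = (coord c w').2 i j by [].
  rewrite -mag_horiz_frame // eqT //; last exact: smooth_near_entry Xc s2 fE _ cw.
  rewrite (horiz_sub_vert_entry Xc s2 fE x wFM cw (skT w wFM)).
  by have [_ ->] := is_derive_snd (coord c w)
    (hvec g c (coord c w) x - vvec (coord c w) (T x w)).
have e : (coord c w).2 *m T x w =
    (coord c w).2 *m contorsion_form (Omega_coord c (coord c w)) x.
  have /matrixP h := key; rewrite /mvec /= in h.
  by move: h => /addrI /oppr_inj.
have uA : (coord c w).2 \in unitmx.
  have [_ d0] := FM_coord Xc cw wFM.
  by rewrite unitmxE unitfE gt_eqF.
by rewrite (bOm_coord Om Xc wFM cw) -[LHS](mulKmx uA) e mulKmx.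
Qed.

(** For a general test function the value comes from the hypothesis on [T], now that [T] is known,
    and not from the defining bracket. Only the value of [t] at [w] enters, which reduces a variable
    vector to a constant one. *)
Lemma mag_horiz_entry m m' c (Phi : E -> 'M[R]_(m, m')) f i j t w :
  atlas X c -> smooth_mx_on (dom_coord c) Phi ->
  (forall w, FM g w -> chart_dom c w.1 -> f w = Phi (coord c w) i j) ->
  FM g w -> chart_dom c w.1 ->
  mag_horiz g Om t f w =
  ('D_(mvec c (coord c w) (t w)) Phi (coord c w)) i j.
Proof.
move=> Xc sPhi fE wFM cw; have [skT eqT] := hT (t w).
have -> : mag_horiz g Om t f w = mag_horiz g Om (cst (t w)) f w by [].
rewrite eqT //; last exact: smooth_near_entry Xc sPhi fE _ cw.
rewrite (horiz_sub_vert_entry Xc sPhi fE (t w) wFM cw (skT w wFM)).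
have TE := contorsionE (t w) wFM; rewrite (bOm_coord Om Xc wFM cw) in TE.
exact: (congr1 (fun B => ('D_(hvec g c (coord c w) (t w) - vvec (coord c w) B)
  Phi (coord c w)) i j) TE).
Qed.

End ContorsionFormula.

(** * Curvature *)

Section CurvatureCoordinates.
Context {R : realType} {M : topologicalType} {n : nat}.
Context {X : @oriented_manifold R M n.+1}.
Variables (g : riemannian_metric X).
Implicit Types (c : @chart R M n.+1) (w : @frame R M n).
Implicit Types (x y z u v : 'cV[R]_n.+1).

(** The value on [(u, v)] of [dC + C /\ C], the curvature of the connection form C. *)
Definition curvature_coord c y u v : 'M[R]_n.+1 :=
  dchristoffel g c y u v - dchristoffel g c y v u +
  (christoffel_mx g c y u *m christoffel_mx g c y v -
   christoffel_mx g c y v *m christoffel_mx g c y u).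

Let mulmx_bracket (D1 D2 C1 C2 : 'M[R]_n.+1) z :
  D1 *m z + C1 *m (C2 *m z) - (D2 *m z + C2 *m (C1 *m z)) =
  (D1 - D2 + (C1 *m C2 - C2 *m C1)) *m z.
Proof. by rewrite !mulmxDl !mulNmx !mulmxA opprD addrACA. Qed.

Lemma derive_christoffel c y u v z : atlas X c -> chart_img c y ->
  'D_u (fun s => christoffel g c s v z) y = dchristoffel g c y u v *m z.
Proof.
move=> Xc cy.
have ny : \forall s \near y, chart_img c s.
  by apply: open_nbhs_nbhs; split=> //; exact: chart_img_openP.
have e : \forall s \near y,
    christoffel_mx g c s v *m z = christoffel g c s v z.
  by apply: filterS ny => s cs; exact: christoffel_mxE.
rewrite -(near_eq_derive _ e).
have e' : \forall s \near y,
    \sum_l v l 0 *: christoffel_mx g c s (basisv l) = christoffel_mx g c s v.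
  by apply: filterS ny => s cs; rewrite [RHS](christoffel_mx_sum g _ Xc cs).
have dC : is_derive y u (fun s => \sum_l v l 0 *: christoffel_mx g c s (basisv l))
    (dchristoffel g c y u v).
  apply: is_derive_sum_in => l _; apply: is_deriveZ.
  exact: is_derive_smooth_mx (christoffel_mx_smooth g (basisv l) Xc) cy.
have [_ ->] := is_derive_mulmx (near_eq_is_derive e' dC) (is_derive_cst z y u).
by rewrite mulmx0 addr0.
Qed.

Lemma covariant_cst c u z :
  covariant g c (cst u) (cst z) = (fun y => christoffel g c y u z).
Proof. by apply/funext => y; rewrite /covariant derive_cst add0r. Qed.

Lemma curvature_field_coord c y u v z : atlas X c -> chart_img c y ->
  curvature_field g c (cst u) (cst v) (cst z) y = curvature_coord c y u v *m z.
Proof.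
move=> Xc cy.
have covE (f : 'cV[R]_n.+1 -> 'cV[R]_n.+1) v' :
    covariant g c (cst v') f y = 'D_v' f y + christoffel g c y v' (f y) by [].
have fb : field_bracket (cst u) (cst v) = cst 0.
  by apply/funext => s; rewrite /field_bracket !derive_cst subrr.
have C0 : christoffel_mx g c y 0 = 0.
  by rewrite (christoffel_mx_sum g _ Xc cy) big1 // => l _; rewrite mxE scale0r.
rewrite /curvature_field fb !covariant_cst !covE.
rewrite (derive_christoffel _ _ _ Xc cy) (derive_christoffel _ _ _ Xc cy).
rewrite -!(christoffel_mxE g _ _ Xc cy) C0 mul0mx subr0.
exact: mulmx_bracket.
Qed.

Lemma curvature_mx_coord w x y : FM g w ->
  curvature_mx g x y w = invmx w.2 *m
    (curvature_coord (chart_at X w.1) (chart_at X w.1 w.1) (w.2 *m x) (w.2 *m y)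
     *m w.2).
Proof.
move=> wFM; apply/matrixP => i j; rewrite mxE /curvature.
have cy : chart_img (chart_at X w.1) (chart_at X w.1 w.1).
  by exists w.1 => //; exact: chart_at_dom.
rewrite (curvature_field_coord _ _ _ (chart_at_atlas X _) cy).
by rewrite !mulmxA -colE mxE.
Qed.

Lemma christoffel_mx_sub c y u v : atlas X c -> chart_img c y ->
  christoffel_mx g c y (u - v) = christoffel_mx g c y u - christoffel_mx g c y v.
Proof.
move=> Xc cy; rewrite !(christoffel_mx_sum g _ Xc cy) -sumrB.
by apply: eq_bigr => l _; rewrite -scalerBl !mxE.
Qed.

Lemma derive_smooth_mxB (V : normedModType R) m m' (U : set V)
    (A : V -> 'M[R]_(m, m')) (q a b : V) : smooth_mx_on U A -> U q ->
  'D_(a - b) A q = 'D_a A q - 'D_b A q.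
Proof.
move=> sA Uq; apply/matrixP => i j; rewrite !mxE.
have dE d : ('D_d A q) i j = 'D_d (fun p => A p i j) q.
  by have /is_derive_mxP/(_ i j)[_ ->] := is_derive_smooth_mx d sA Uq.
have df : differentiable (fun p => A p i j) q.
  exact: smooth_on_differentiable (sA i j) Uq.
by rewrite !dE !deriveE // linearB.
Qed.

End CurvatureCoordinates.

(* [mx] and [my] are the matrix parts of [m_x] and [m_y]; [P0], [P1] and [P2]
   stand for [C(A tau)], [C(mx y)] and [C(my x)], [dxy] for the derivative of [C]
   along [A x] evaluated at [A y], and [Dxy] for the derivative of [T_y] along
   [m_x]. *)
Lemma structure_equation (R : comPzRingType) m
    (A Cx Cy Tx Ty Tt RO P0 P1 P2 dxy dyx Dxy Dyx mx my : 'M[R]_m) :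
  mx = - (Cx *m A + A *m Tx) -> my = - (Cy *m A + A *m Ty) ->
  P1 - P2 = - P0 ->
  - (- ((P1 + dxy) *m A + Cy *m mx + (mx *m Ty + A *m Dxy)) -
     - ((P2 + dyx) *m A + Cx *m my + (my *m Tx + A *m Dyx))) =
  - (P0 *m A + A *m Tt) + A *m RO ->
  A *m RO = (dxy - dyx + (Cx *m Cy - Cy *m Cx)) *m A +
    A *m (Tt - (Tx *m Ty - Ty *m Tx) + (Dxy - Dyx)).
Proof.
move=> -> -> hP; have -> : P1 = P2 - P0 by rewrite -hP addrC subrK.
rewrite !(mulmxDl, mulmxDr, mulNmx, mulmxN, mulmxA).
move: (P2 *m A) (P0 *m A) (dxy *m A) (dyx *m A) (Cy *m Cx *m A) (Cx *m Cy *m A).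
move: (Cy *m A *m Tx) (Cx *m A *m Ty) (A *m Tx *m Ty) (A *m Ty *m Tx).
move: (A *m Dxy) (A *m Dyx) (A *m Tt) (A *m RO).
move=> a1 a2 a3 a4 a5 a6 a7 a8 a9 b1 b2 b3 b4 b5 h.
apply/matrixP => i j; move/matrixP/(_ i j): h; rewrite !mxE.
move: (a1 i j) (a2 i j) (a3 i j) (a4 i j) (a5 i j) (a6 i j) (a7 i j) (a8 i j).
move: (a9 i j) (b1 i j) (b2 i j) (b3 i j) (b4 i j) (b5 i j).
move=> c1 c2 c3 c4 c5 c6 c7 c8 c9 d1 d2 d3 d4 d5 h.
by rewrite -[LHS](addNKr (c2 + c9)) -h; ring.
Qed.

(** The Christoffel terms cancel by symmetry, which leaves only the contorsion. *)
Lemma torsion_equation (R : comUnitRingType) m (A Cx Cy Tx Ty mx my : 'M[R]_m)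
    (t x y : 'cV[R]_m) : A \in unitmx ->
  mx = - (Cx *m A + A *m Tx) -> my = - (Cy *m A + A *m Ty) ->
  Cx *m (A *m y) = Cy *m (A *m x) ->
  - (mx *m y - my *m x) = A *m t -> t = Tx *m y - Ty *m x.
Proof.
move=> uA -> -> symC h; rewrite -[LHS](mulKmx uA) -h.
have -> : - (- (Cx *m A + A *m Tx) *m y - - (Cy *m A + A *m Ty) *m x) =
    A *m (Tx *m y - Ty *m x); last by rewrite mulKmx.
rewrite !mulNmx !mulmxDl mulmxBr -!mulmxA symC.
move: (Cy *m _) (A *m (Tx *m y)) (A *m (Ty *m x)) => a b d.
by apply/colP => i; rewrite !mxE; ring.
Qed.

Lemma collect_terms (R : comPzRingType) m m'
    (a t k h1 h2 d1 d2 : 'M[R]_(m, m')) :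
  a + (t - k + (h1 - d1 - (h2 - d2))) = a + h1 - h2 + (t - k - d1 + d2).
Proof. by apply/matrixP => i j; rewrite !mxE; ring. Qed.

Lemma entry_oppB_add (V : zmodType) m m' (P Q S D : 'M[V]_(m, m')) i j :
  - (P i j - Q i j) = S i j + D i j -> (- (P - Q)) i j = (S + D) i j.
Proof. by rewrite !mxE. Qed.

Theorem proposition3p14 (R : realType) (n : nat) (M : topologicalType)
    (X : @oriented_manifold R M n.+1) (g : riemannian_metric X)
    (Om : two_form X)
    (T : 'cV[R]_n.+1 -> @frame R M n -> 'M[R]_n.+1)
    (tau : 'cV[R]_n.+1 -> 'cV[R]_n.+1 -> @frame R M n -> 'cV[R]_n.+1)
    (RO : 'cV[R]_n.+1 -> 'cV[R]_n.+1 -> @frame R M n -> 'M[R]_n.+1)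
    (hT : is_contorsion g Om T)
    (hRO : is_torsion_curvature g Om tau RO)
    (x y : 'cV[R]_n.+1) (w : @frame R M n) (hw : FM g w) :
  RO x y w =
    curvature_mx g x y w + horiz_mx g x (T y) w - horiz_mx g y (T x) w
    + 4^-1 *:
      (dot (bOm g Om w *m e1) (bOm g Om w *m e1) *: wedge (perp x) (perp y)
       + wedge (perp (bOm g Om w *m bOm g Om w *m x)) y
       + wedge x (perp (bOm g Om w *m bOm g Om w *m y))
       - wedge (bOm g Om w *m x) (bOm g Om w *m y)
       - (2 * so_dot (bOm g Om w) (wedge x y)) *: bOm g Om w).
Proof.
set c := chart_at X w.1.
have Xc : atlas X c := chart_at_atlas X w.1.
have cw : chart_dom c w.1 := chart_at_dom X w.1.
pose cd w' := coord (X := X) c w'.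
set q := cd w.
have cq : dom_coord c q := coord_dom cw.
have qA : q.2 = w.2 by exact: frame_coord_at.
have uA : w.2 \in unitmx.
  by have [_ d0] := hw; rewrite unitmxE unitfE gt_eqF.
pose B := bOm g Om w.
have skB : Defs.skew B := bOm_skew Om hw.
have BE : Omega_coord Om c q = B by rewrite /B (bOm_coord Om Xc hw cw).
pose Tx := contorsion_form B x; pose Ty := contorsion_form B y.
have [skRO eqRO] := hRO x y.
pose mx := mvec g Om c q x; pose my := mvec g Om c q y.
pose C u := christoffel_mx g c q.1 u.
have mE2 u : (mvec g Om c q u).2 =
    - (C (w.2 *m u) *m w.2 + w.2 *m contorsion_form B u).
  by rewrite -qA -BE; exact: mvec2.
have oU := @dom_coord_open R M n c.
have s1 : smooth_mx_on (dom_coord c) (fun r : 'cV[R]_n.+1 * 'M[R]_n.+1 => r.1).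
  apply: smooth_on_mx => //; exact: smooth_on_lin (@fst_continuous R n).
have s2 := @smooth_snd R M n c.
(* If the derivative of [Phi] along [m_u] is a known smooth function [D u], the equation between
   fields, tested on the entries of [Phi], becomes one between first derivatives of [D]. *)
have bracketE m m' (Phi : 'cV[R]_n.+1 * 'M[R]_n.+1 -> 'M[R]_(m, m'))
    (D : 'cV[R]_n.+1 -> 'cV[R]_n.+1 * 'M[R]_n.+1 -> 'M[R]_(m, m')) :
    smooth_mx_on (dom_coord c) Phi ->
    (forall u, smooth_mx_on (dom_coord c) (D u)) ->
    (forall u r, dom_coord c r -> 'D_(mvec g Om c r u) Phi r = D u r) ->
    - ('D_mx (D y) q - 'D_my (D x) q) =
    D (tau x y w) q + 'D_(vvec q (RO x y w)) Phi q.
  move=> sPhi sD DE; apply/matrixP => i j.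
  pose f w' := Phi (cd w') i j.
  have fE w' : FM g w' -> chart_dom c w'.1 -> f w' = Phi (cd w') i j by [].
  have magf u w' : FM g w' -> chart_dom c w'.1 ->
      mag_horiz g Om (cst u) f w' = D u (cd w') i j.
    move=> FMw' cw'; rewrite (mag_horiz_entry hT (cst u) Xc sPhi fE FMw' cw').
    by rewrite -(DE u) //; exact: coord_dom.
  have mm u v : mag_horiz g Om (cst u) (mag_horiz g Om (cst v) f) w =
      ('D_(mvec g Om c q u) (D v) q) i j.
    exact: (mag_horiz_entry hT (cst u) Xc (sD v) (magf v) hw cw).
  have := eqRO f w hw (smooth_near_entry Xc sPhi fE cw).
  rewrite /vfield_bracket !mm (vert_fun_entry Xc sPhi fE hw cw (skRO w hw)).
  rewrite (mag_horiz_entry hT (tau x y) Xc sPhi fE hw cw) DE //.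
  exact: entry_oppB_add.
(* Vertical fields do not move the base point, so this test sees the torsion alone. *)
have torsion : - (mx.2 *m y - my.2 *m x) = w.2 *m tau x y w.
  have Dfst (r v : 'cV[R]_n.+1 * 'M[R]_n.+1) :
      'D_v (fun r : 'cV[R]_n.+1 * 'M[R]_n.+1 => r.1) r = v.1.
    by have [] := is_derive_fst r v.
  have Dsnd (r v : 'cV[R]_n.+1 * 'M[R]_n.+1) (u : 'cV[R]_n.+1) :
      'D_v (fun r : 'cV[R]_n.+1 * 'M[R]_n.+1 => r.2 *m u) r = v.2 *m u.
    have [_ ->] := is_derive_mulmx (is_derive_snd r v) (is_derive_cst u r v).
    by rewrite mulmx0 addr0.
  have sD (u : 'cV[R]_n.+1) : smooth_mx_on (dom_coord c)
      (fun r : 'cV[R]_n.+1 * 'M[R]_n.+1 => r.2 *m u).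
    by apply: smooth_mx_mul => //; exact: smooth_mx_cst.
  have := bracketE _ _ _ (fun u r => r.2 *m u) s1 sD; rewrite !Dsnd Dfst addr0 qA; apply.
  by move=> u r _; rewrite Dfst mvec1.
(* Here the vertical field contributes [A] times the curvature, which can be isolated once the
   torsion is known. *)
have curv : - ('D_mx (fun r => (mvec g Om c r y).2) q -
    'D_my (fun r => (mvec g Om c r x).2) q) =
    (mvec g Om c q (tau x y w)).2 + w.2 *m RO x y w.
  have Dsnd (r v : 'cV[R]_n.+1 * 'M[R]_n.+1) :
      'D_v (fun r : 'cV[R]_n.+1 * 'M[R]_n.+1 => r.2) r = v.2.
    by have [] := is_derive_snd r v.
  have := bracketE _ _ _ (fun u r => (mvec g Om c r u).2) s2
    (fun u => mvec2_smooth g Om u Xc) (fun u r _ => Dsnd r _).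
  have v2 : (vvec q (RO x y w)).2 = w.2 *m RO x y w by rewrite -qA.
  by rewrite Dsnd v2.
have Cq : chart_img c q.1 := cq.
have symC : C (w.2 *m x) *m (w.2 *m y) = C (w.2 *m y) *m (w.2 *m x).
  rewrite /C (christoffel_mxE g _ _ Xc Cq) (christoffel_mxE g _ _ Xc Cq).
  exact: christoffel_torsion_free.
have tauE : tau x y w = Tx *m y - Ty *m x.
  exact: torsion_equation uA (mE2 x) (mE2 y) symC torsion.
have horizT u v : horiz_mx g u (T v) w =
    contorsion_form ('D_(hvec g c q u) (Omega_coord Om c) q) v.
  have sF := contorsion_coord_smooth Om v Xc.
  apply/matrixP => i j; rewrite mxE.
  have fE w' : FM g w' -> chart_dom c w'.1 ->
      T v w' i j = contorsion_form (Omega_coord Om c (cd w')) v i j.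
    by move=> FMw' cw'; rewrite (contorsionE hT v FMw') (bOm_coord Om Xc FMw' cw').
  rewrite (horiz_entry Xc sF fE u hw cw).
  by have [_ ->] := is_derive_contorsion Om (hvec g c q u) v Xc cq.
(* The direction [m_u] is the horizontal one minus the vertical one of [T_u]. The horizontal part
   gives the derivative of [T_v] in the statement, the vertical part a commutator. *)
have dOm u v : contorsion_form ('D_(mvec g Om c q u) (Omega_coord Om c) q) v =
    horiz_mx g u (T v) w -
    contorsion_form (B *m contorsion_form B u - contorsion_form B u *m B) v.
  have e : 'D_(mvec g Om c q u) (Omega_coord Om c) q =
      'D_(hvec g c q u) (Omega_coord Om c) q -
      (B *m contorsion_form B u - contorsion_form B u *m B).
    rewrite /mvec (derive_smooth_mxB _ _ (Omega_coord_smooth Om Xc) cq).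
    congr (_ - _); rewrite (derive_Omega_vert Om Xc cq) BE //.
    exact: contorsion_form_skew.
  by rewrite e horizT; exact: contorsion_formB.
have RE : curvature_mx g x y w = invmx w.2 *m
    (curvature_coord g c q.1 (w.2 *m x) (w.2 *m y) *m w.2).
  exact: curvature_mx_coord.
(* In the derivative of C(A y) along [m_x] the argument varies by [mx.2 *m y]; antisymmetrized in x
   and y, this is the torsion equation again. *)
have hP : C (mx.2 *m y) - C (my.2 *m x) = - C (w.2 *m tau x y w).
  by rewrite -torsion opprB /C (christoffel_mx_sub g _ _ Xc Cq) opprB.
have dm (v : 'cV[R]_n.+1 * 'M[R]_n.+1) u z : v.1 = w.2 *m u ->
    'D_v (fun r => (mvec g Om c r z).2) q =
    - ((C (v.2 *m z) + dchristoffel g c q.1 (w.2 *m u) (w.2 *m z)) *m w.2 +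
       C (w.2 *m z) *m v.2 + (v.2 *m contorsion_form B z +
       w.2 *m contorsion_form ('D_v (Omega_coord Om c) q) z)).
  move=> <-; rewrite -BE -qA.
  by have [_] := is_derive_mvec2 g Om v z Xc cq.
have mx1 : mx.1 = w.2 *m x by rewrite -qA; exact: mvec1.
have my1 : my.1 = w.2 *m y by rewrite -qA; exact: mvec1.
have curv' := etrans (etrans
  (congr2 (fun P Q => - (P - Q)) (esym (dm mx x y mx1)) (esym (dm my y x my1)))
  curv) (congr1 (fun P => P + w.2 *m RO x y w) (mE2 (tau x y w))).
have key := structure_equation (mE2 x) (mE2 y) hP curv'.
have ROE : RO x y w = curvature_mx g x y w +
    (contorsion_form B (tau x y w) - (Tx *m Ty - Ty *m Tx) +
     (contorsion_form ('D_mx (Omega_coord Om c) q) y -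
      contorsion_form ('D_my (Omega_coord Om c) q) x)).
  by rewrite RE -[LHS](mulKmx uA) key mulmxDr (mulKmx uA).
(* The commutators from [dOm] join the torsion term and the commutator of [Tx] and [Ty] to form the
   left-hand side of [contorsion_curvature_algebra]. *)
have S1 := congr2 (fun P Q : 'M[R]_n.+1 => P - Q) (dOm x y) (dOm y x).
have S2 := congr1 (contorsion_form B) tauE.
have S3 := contorsion_curvature_algebra skB x y.
apply: (etrans ROE).
apply: (etrans (congr2 (fun P Q : 'M[R]_n.+1 => curvature_mx g x y w +
  (P - (Tx *m Ty - Ty *m Tx) + Q)) S2 S1)).
apply: (etrans (collect_terms _ _ _ _ _ _ _)).
exact: (congr1 (fun P : 'M[R]_n.+1 => curvature_mx g x y w +
  horiz_mx g x (T y) w - horiz_mx g y (T x) w + P) S3).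
Qed.
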